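(* Let $\lambda/\mu$ be a skew shape (partitions $\mu\subseteq\lambda$). Then $$\sum_{\pi\in\mathrm{RPP}(\lambda/\mu)}q^{|\pi|}\,t^{\mathrm{tr}(\pi)}\;=\;\sum_{D\in\mathcal{E}(\lambda/\mu)}q^{a'(D)}\,t^{c(D)}\prod_{u\in\overline{D}\cap\square^\lambda}\frac{1}{1-t\,q^{h(u)}}\prod_{u\in\overline{D}\setminus\square^\lambda}\frac{1}{1-q^{h(u)}},$$ where $\overline{D}=[\lambda]\setminus D$, $a'(D)=\sum_{u\in\Lambda(D)}h(u)$, $c(D)=|\Lambda(D)\cap\square^\lambda|$, $\Lambda(D)$ is the set of excited peaks of $D$, and $\square^\lambda$ is the Durfee square of $\lambda$.
   Context: $[\lambda]=\{(i,j):1\le i\le \ell(\lambda),\,1\le j\le\lambda_i\}$ is the Young diagram (rows numbered from the top, columns from the left), $\lambda'$ is the conjugate partition, and $h(i,j)=\lambda_i-i+\lambda'_j-j+1$ is the hook-length in $\lambda$. The Durfee square $\square^\lambda$ is the largest square $\{(i,j):1\le i,j\le k\}$ contained in $[\lambda]$. $\mathrm{RPP}(\lambda/\mu)$ is the set of reverse plane partitions of shape $\lambda/\mu$: fillings $\pi$ of $[\lambda]\setminus[\mu]$ with nonnegative integers, weakly increasing along rows and down columns; $|\pi|$ is the sum of the entries and $\mathrm{tr}(\pi)=\sum_i\pi_{i,i}$ (sum over diagonal cells of $[\lambda]\setminus[\mu]$). Excited diagrams: for $D\subseteq[\lambda]$, a cell $u=(i,j)\in D$ is active if $(i+1,j)$,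 $(i,j+1)$, $(i+1,j+1)$ all lie in $[\lambda]\setminus D$; the excited move $\alpha_u$ at an active cell $u=(i,j)$ replaces $(i,j)$ in $D$ by $(i+1,j+1)$. $\mathcal{E}(\lambda/\mu)$ is the set of all subsets of $[\lambda]$ obtained from $[\mu]$ by a (possibly empty) sequence of excited moves. Excited peaks: to each $D\in\mathcal{E}(\lambda/\mu)$ is associated a subset $\Lambda(D)\subseteq[\lambda]\setminus D$, defined by $\Lambda([\mu])=\varnothing$ and, for an active cell $u=(i,j)$ of $D$, $\Lambda(\alpha_u(D))=\bigl(\Lambda(D)\setminus\{(i,j+1),(i+1,j)\}\bigr)\cup\{u\}$ (this does not depend on the sequence of excited moves used to reach $D$). *)

(* Defs.v *)
From HB Require Import structures.
From mathcomp Require Import all_boot all_order all_algebra.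
From mathcomp Require Import finmap.
From mathcomp Require Import boolp classical_sets functions cardinality fsbigop.
From mathcomp Require Import zify.

Set Implicit Arguments.
Unset Strict Implicit.
Unset Printing Implicit Defensive.

Import GRing.Theory.

(* Formal power series over R; the equality and choice structures are the    *)
(* classical ones. Iterating the construction, fps (fps R) is R[[t]][[q]].   *)
Section FormalPowerSeries.
Local Open Scope ring_scope.
Variable R : comNzRingType.

Record fps := Fps { fcoef : nat -> R }.

HB.instance Definition _ := gen_eqMixin fps.
HB.instance Definition _ := gen_choiceMixin fps.

Implicit Types f g h : fps.

Lemma fpsP f g : (forall n, fcoef f n = fcoef g n) <-> f = g.
Proof.
split=> [|-> //]; case: f g => [f] [g] /= fg.
by congr Fps; apply: funext.
Qed.

Definition fps_zero := Fps (fun=> 0).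
Definition fps_opp f := Fps (fun n => - fcoef f n).
Definition fps_add f g := Fps (fun n => fcoef f n + fcoef g n).

Fact fps_addA : associative fps_add.
Proof. by move=> f g h; apply/fpsP => n /=; rewrite addrA. Qed.
Fact fps_addC : commutative fps_add.
Proof. by move=> f g; apply/fpsP => n /=; rewrite addrC. Qed.
Fact fps_add0 : left_id fps_zero fps_add.
Proof. by move=> f; apply/fpsP => n /=; rewrite add0r. Qed.
Fact fps_addN : left_inverse fps_zero fps_opp fps_add.
Proof. by move=> f; apply/fpsP => n /=; rewrite addNr. Qed.

HB.instance Definition _ :=
  GRing.isZmodule.Build fps fps_addA fps_addC fps_add0 fps_addN.

Definition fpsC (c : R) := Fps (fun n => if n is 0 then c else 0).
Definition fpsX := Fps (fun n => (n == 1)%:R).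

Definition fps_mul f g :=
  Fps (fun n => \sum_(i < n.+1) fcoef f i * fcoef g (n - i)).

Fact fps_mulC : commutative fps_mul.
Proof.
move=> f g; apply/fpsP => n /=; rewrite (reindex_inj rev_ord_inj) /=.
by apply: eq_bigr => i _; rewrite mulrC !subSS subKn // -ltnS.
Qed.

Fact fps_mulA : associative fps_mul.
Proof.
move=> f g h; apply/fpsP => n /=; symmetry.
pose F i j k := fcoef f i * fcoef g j * fcoef h k.
transitivity (\sum_(0 <= i < n.+1) \sum_(0 <= j < n.+1 | (j <= i)%N)
   F j (i - j)%N (n - i)%N).
  rewrite big_mkord; apply: eq_bigr => i _.
  rewrite mulr_suml (big_ord_widen n.+1
    (fun j => fcoef f j * fcoef g (i - j) * fcoef h (n - i))) // big_mkord.
  by apply: eq_bigl => j; rewrite ltnS.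
rewrite (exchange_big_dep_nat xpredT) //= big_mkord; apply: eq_bigr => j _.
rewrite mulr_sumr -(big_mkord xpredT (fun i =>
  fcoef f j * (fcoef g i * fcoef h (n - j - i)))).
have jn : (j <= n)%N by rewrite -ltnS.
rewrite (@big_cat_nat _ _ _ j) //=; last by rewrite ltnW.
rewrite big_nat_cond big1 ?add0r; last by move=> i; lia.
rewrite -{1}(add0n (j : nat)) big_addn subSn // big_nat_cond [RHS]big_nat_cond.
apply: eq_big => [i|i _]; first by lia.
by rewrite /F addnK -mulrA addnC subnDA.
Qed.

Fact fps_mul1 : left_id (fpsC 1) fps_mul.
Proof.
move=> f; apply/fpsP => n /=.
by rewrite big_ord_recl /= mul1r subn0 big1 ?addr0 // => i _; rewrite mul0r.
Qed.

Fact fps_mulDl : left_distributive fps_mul fps_add.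
Proof.
move=> f g h; apply/fpsP => n /=; rewrite -big_split.
by apply: eq_bigr => i _; rewrite mulrDl.
Qed.

Fact fps_one_neq0 : fpsC 1 != 0.
Proof. by apply/eqP => /fpsP/(_ 0%N)/eqP /=; rewrite oner_eq0. Qed.

HB.instance Definition _ := GRing.Zmodule_isComNzRing.Build fps
  fps_mulA fps_mulC fps_mul1 fps_mulDl fps_one_neq0.

(* Inverses are unique when they exist; see fps_unit1B and mulrV.            *)
Definition fps_unit : {pred fps} := [pred f | `[< exists g, g * f = 1 >]].
Definition fps_inv f := xget f [set g | g * f = 1]%classic.

Fact fps_mulVr : {in fps_unit, left_inverse 1 fps_inv *%R}.
Proof.
by move=> f /asboolP[g gf]; apply: (@xgetI _ f [set g | g * f = 1]%classic g).
Qed.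
Fact fps_unitPl f g : g * f = 1 -> fps_unit f.
Proof. by move=> gf; apply/asboolP; exists g. Qed.
Fact fps_inv_out : {in [predC fps_unit], fps_inv =1 id}.
Proof.
move=> f /asboolP nf; rewrite /fps_inv; case: xgetP => // g _ gf.
by case: nf; exists g.
Qed.

HB.instance Definition _ := GRing.ComNzRing_hasMulInverse.Build fps
  fps_mulVr fps_unitPl fps_inv_out.

Lemma fcoef0 n : fcoef 0 n = 0. Proof. by []. Qed.
Lemma fcoef1 n : fcoef 1 n = (n == 0)%:R. Proof. by case: n. Qed.
Lemma fcoefD f g n : fcoef (f + g) n = fcoef f n + fcoef g n.
Proof. by []. Qed.
Lemma fcoefN f n : fcoef (- f) n = - fcoef f n. Proof. by []. Qed.
Lemma fcoefM f g n :
  fcoef (f * g) n = \sum_(i < n.+1) fcoef f i * fcoef g (n - i).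
Proof. by []. Qed.

Lemma fcoefXM f n : fcoef (fpsX * f) n = if n is n'.+1 then fcoef f n' else 0.
Proof.
rewrite fcoefM big_ord_recl /= mul0r add0r; case: n => [|n]; first by rewrite big_ord0.
rewrite big_ord_recl /= mul1r subn1 big1 ?addr0 //.
by move=> i _; rewrite mul0r.
Qed.

Lemma fcoefXnM k f n :
  fcoef (fpsX ^+ k * f) n = if (k <= n)%N then fcoef f (n - k) else 0.
Proof.
elim: k n => [|k IH] n; first by rewrite expr0 mul1r subn0.
by rewrite exprS -mulrA fcoefXM; case: n => // n; rewrite IH subSS ltnS.
Qed.

Lemma fcoefCM c f n : fcoef (fpsC c * f) n = c * fcoef f n.
Proof.
by rewrite fcoefM big_ord_recl /= subn0 big1 ?addr0 // => i _; rewrite mul0r.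
Qed.

Lemma fpsCM c d : fpsC (c * d) = fpsC c * fpsC d.
Proof. by apply/fpsP => n; rewrite fcoefCM; case: n => //= n; rewrite mulr0. Qed.

Lemma fps_unit1B c k :
  (0 < k)%N -> (1 - fpsC c * fpsX ^+ k) \is a GRing.unit.
Proof.
move=> k0; apply: (@fps_unitPl _
  (Fps (fun n => if (k %| n)%N then c ^+ (n %/ k) else 0))).
rewrite [LHS]mulrC mulrBl mul1r -mulrA; apply/fpsP => n.
rewrite fcoefD fcoefN fcoefCM fcoefXnM fcoef1 /=.
have [kn|nk] := leqP k n; last first.
  rewrite mulr0 subr0; case: (posnP n) => [->|n0]; first by rewrite dvdn0 div0n.
  by rewrite gtnNdvd // -[(n == 0)%N]negbK -lt0n n0.
have -> : (n == 0)%N = false by lia.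
rewrite -{1 2}(subnK kn) dvdn_addl // divnDr // divnn k0 addn1 exprS.
by case: ifP; rewrite ?mulr0 subrr.
Qed.

(* Sum of a possibly infinite family, coefficient by coefficient.  It is the *)
(* intended sum only when the family is summable: \sum_(x \in A) is 0 on     *)
(* families of infinite support.                                             *)
Definition fps_summable {T : choiceType} (A : set T) (F : T -> fps) :=
  forall n, finite_set (A `&` [set x | fcoef (F x) n != 0])%classic.

Definition fps_sum {T : choiceType} (A : set T) (F : T -> fps) :=
  Fps (fun n => \sum_(x \in A) fcoef (F x) n).

End FormalPowerSeries.

Arguments fcoef {R} f n : simpl never.
Arguments fpsX {R}.

(* int[[q, t]], as int[[t]][[q]] *)
Notation fps_qt := (fps (fps int)).

Definition q : fps_qt := fpsX.
Definition t : fps_qt := fpsC fpsX.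

Lemma unit_1Bq k : (0 < k)%N -> (1 - q ^+ k)%R \is a GRing.unit.
Proof. by move=> k0; rewrite -[(q ^+ k)%R]mul1r; apply: (fps_unit1B 1%R). Qed.

Lemma unit_1Btq k : (0 < k)%N -> (1 - t * q ^+ k)%R \is a GRing.unit.
Proof. exact: fps_unit1B. Qed.

(* A partition is the weakly decreasing sequence of its positive parts.      *)
Definition is_part (la : seq nat) := sorted geq la && (0 \notin la).

(* Cells are 0-based: (i, j) stands for the cell in row i+1, column j+1.     *)
Notation cell := (nat * nat)%type.

Section Shapes.
Local Open Scope fset_scope.
Implicit Types (la mu : seq nat) (u v : cell) (D L : {fset cell}).

Definition diagram la : {fset cell} :=
  [fset u in [seq (i, j) | i <- iota 0 (size la), j <- iota 0 (nth 0 la i)]].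

Lemma in_diagram la u : (u \in diagram la) = (u.2 < nth 0 la u.1).
Proof.
case: u => i j; rewrite !inE; apply/allpairsPdep/idP => /=.
  by move=> [i' [j' []]]; rewrite !mem_iota /= => _ ? [-> ->].
move=> lt_j; exists i, j; rewrite !mem_iota /= !add0n; split=> //.
by case: (ltnP i (size la)) lt_j => // /(@nth_default _ 0) ->.
Qed.

Definition conj_part la (j : nat) := count (fun p => j < p) la.

(* In 1-based coordinates, (la_i - j) + (la'_j - i) + 1; no subtraction is   *)
(* truncated when u is a cell of la.                                         *)
Definition hook la u :=
  ((nth 0 la u.1 - u.2.+1) + (conj_part la u.2 - u.1.+1) + 1)%N.

Definition square (k : nat) : {fset cell} :=
  [fset u in [seq (i, j) | i <- iota 0 k, j <- iota 0 k]].

Definition durfee la : {fset cell} :=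
  square (\max_(k < (size la).+1 | square k `<=` diagram la) k).

Lemma in_square k u : (u \in square k) = (u.1 < k) && (u.2 < k).
Proof.
case: u => i j; rewrite !inE; apply/allpairsPdep/andP => /=.
  by move=> [i' [j' []]]; rewrite !mem_iota /= => ? ? [-> ->].
by move=> [lt_i lt_j]; exists i, j; rewrite !mem_iota.
Qed.

Lemma durfee_max la k : square k `<=` diagram la -> square k `<=` durfee la.
Proof.
move=> sk; have k_le : k < (size la).+1.
  case: k sk => // k /fsubsetP/(_ (k, 0)).
  rewrite in_square in_diagram /= !ltnS leqnn => /(_ isT).
  by case: (ltnP k (size la)) => // /(@nth_default _ 0) ->.
apply/fsubsetP => u; rewrite !in_square => /andP[u1 u2].
have := @leq_bigmax_cond _ (fun i : 'I_(size la).+1 => square i `<=` diagram la)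
  (fun i => nat_of_ord i) (Ordinal k_le) sk.
by move=> /= le_k; rewrite !(leq_trans _ le_k).
Qed.

Lemma durfee_sub la : durfee la `<=` diagram la.
Proof.
pose P (i : 'I_(size la).+1) := square i `<=` diagram la.
have P0 : 0 < #|P|.
  by apply/card_gt0P; exists ord0; apply/fsubsetP => u; rewrite in_square ltn0.
by rewrite /durfee; have [i Pi ->] := eq_bigmax_cond (@nat_of_ord _) P0.
Qed.

Definition skew la mu := diagram la `\` diagram mu.

End Shapes.

Section ReversePlanePartitions.
Variables la mu : seq nat.

Definition filling := {ffun skew la mu -> nat}.

Definition rpp : set filling :=
  [set pi : filling | forall u v : skew la mu,
     ((val u).1 = (val v).1 -> (val u).2 <= (val v).2 -> pi u <= pi v) /\
     ((val u).2 = (val v).2 -> (val u).1 <= (val v).1 -> pi u <= pi v)]%classic.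

Definition rpp_size (pi : filling) := \sum_u pi u.

Definition rpp_trace (pi : filling) :=
  \sum_(u : skew la mu | (val u).1 == (val u).2) pi u.

Definition rpp_weight (pi : filling) : fps_qt :=
  (q ^+ rpp_size pi * t ^+ rpp_trace pi)%R.

Lemma rpp_summable : fps_summable rpp rpp_weight.
Proof.
move=> n; pose F (g : {ffun skew la mu -> 'I_n.+1}) : filling :=
  [ffun u => nat_of_ord (g u)].
apply: (@sub_finite_set _ _ (F @` setT)); last first.
  by apply: finite_image; exact: finite_finset.
move=> pi []; rewrite /rpp_weight /q => _; rewrite /mkset fcoefXnM.
case: leqP => [|_]; last by rewrite eqxx.
rewrite leq_eqVlt => /predU1P[sz_n _|sz_n]; last first.
  have -> : (t ^+ rpp_trace pi)%R = fpsC (fpsX ^+ rpp_trace pi)%R :> fps_qt.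
    by elim: (rpp_trace pi) => [//|k IH]; rewrite !exprS IH fpsCM.
  by case: (n - _) (subn_gt0 (rpp_size pi) n) => [|m]; rewrite sz_n // eqxx.
have lt_pi u : pi u < n.+1.
  by rewrite ltnS -sz_n /rpp_size (bigD1 u) //= leq_addr.
by exists [ffun u => Ordinal (lt_pi u)] => //; apply/ffunP => u; rewrite !ffunE.
Qed.

End ReversePlanePartitions.

Arguments rpp : clear implicits.

Section ExcitedDiagrams.
Local Open Scope fset_scope.
Variables la mu : seq nat.
Implicit Types (u v : cell) (D L E M : {fset cell}).

Definition cellE u : cell := (u.1, u.2.+1).
Definition cellS u : cell := (u.1.+1, u.2).
Definition cellSE u : cell := (u.1.+1, u.2.+1).

Definition active D u :=
  [&& u \in D, cellS u \in diagram la `\` D, cellE u \in diagram la `\` D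
    & cellSE u \in diagram la `\` D].

Definition excited_move u D := cellSE u |` (D `\ u).

Inductive excited : {fset cell} -> Prop :=
| excited_start : excited (diagram mu)
| excited_step D u : excited D -> active D u -> excited (excited_move u D).

Definition excited_diagrams : {fset {fset cell}} :=
  [fset D in fpowerset (diagram la) | `[< excited D >]].

Definition peak_move u L := u |` (L `\` [fset cellE u; cellS u]).

(* L is obtained as the set of peaks of D along some sequence of moves.      *)
Inductive has_peaks : {fset cell} -> {fset cell} -> Prop :=
| has_peaks_start : has_peaks (diagram mu) fset0
| has_peaks_step D L u : has_peaks D L -> active D u ->
    has_peaks (excited_move u D) (peak_move u L).

(* Characterized by peaks_start and peaks_step.                              *)
Definition peaks D : {fset cell} := xget fset0 [set L | has_peaks D L]%classic.

Lemma in_excited_diagrams D : diagram mu `<=` diagram la ->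
  D \in excited_diagrams <-> excited D.
Proof.
move=> mu_la; rewrite !inE /= fpowersetE; split=> [/andP[_ /asboolP] //|eD].
rewrite (asboolT eD) andbT; elim: eD => // {}D u _ sD /and4P[_ _ _].
rewrite in_fsetD => /andP[_ se]; apply/fsubsetP => w.
rewrite in_fset1U in_fsetD1.
by case/orP => [/eqP-> //|/andP[_ /(fsubsetP sD)]].
Qed.

Lemma active_neq D u v : active D u -> v \in D ->
  [/\ v != cellE u, v != cellS u & v != cellSE u].
Proof.
move=> /and4P[_]; rewrite !in_fsetD => /andP[s _] /andP[e _] /andP[se _] vD.
by split; apply: contraTneq vD => ->.
Qed.

Lemma active_in D u : active D u -> u \in D.
Proof. by case/andP. Qed.

Lemma active_move D u v : active D u -> active D v -> u != v ->
  active (excited_move u D) v.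
Proof.
move=> au av uv; have [vE vS _] := active_neq au (active_in av).
have [uE uS _] := active_neq av (active_in au).
move: av => /and4P[vD]; rewrite /active /excited_move.
rewrite !in_fsetD !in_fset1U !in_fsetD1 => /andP[/negPf s ->].
move=> /andP[/negPf e ->] /andP[/negPf se ->].
rewrite vD (eq_sym v u) uv s e se !andbF !orbF !andbT /=.
by move: u v uv vE vS uE uS {au vD s e se} => [i j] [k l];
  rewrite /cellE /cellS /cellSE /= !xpair_eqE; lia.
Qed.

Lemma excited_moveC D u v : active D u -> active D v -> u != v ->
  excited_move u (excited_move v D) = excited_move v (excited_move u D).
Proof.
move=> au av uv.
have [_ _ uSE] := active_neq av (active_in au).
have [_ _ vSE] := active_neq au (active_in av).
have nSE w : (w == cellSE w) = false.
  by case: w => i j; rewrite /cellSE xpair_eqE /=; lia.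
apply/fsetP => w; rewrite /excited_move !in_fset1U !in_fsetD1 !in_fset1U !in_fsetD1.
have [->|wu] := eqVneq w u; first by rewrite nSE (negPf uSE) andbF.
have [->|wv] := eqVneq w v; first by rewrite nSE (negPf vSE).
by rewrite /= orbCA.
Qed.

Lemma peak_moveC D L u v : active D u -> active D v -> u != v ->
  peak_move u (peak_move v L) = peak_move v (peak_move u L).
Proof.
move=> au av uv.
have [uE uS _] := active_neq av (active_in au).
have [vE vS _] := active_neq au (active_in av).
apply/fsetP => w; rewrite !inE.
have [->|wu] := eqVneq w u; first by rewrite (negPf uE) (negPf uS) /= orbT.
have [->|wv] := eqVneq w v; first by rewrite (negPf vE) (negPf vS).
by rewrite /= andbCA.
Qed.

Inductive reach D L : nat -> {fset cell} -> {fset cell} -> Prop :=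
| reach0 : reach D L 0 D L
| reachS n E M u : reach D L n E M -> active E u ->
    reach D L n.+1 (excited_move u E) (peak_move u M).

Lemma reach_cons D L u n E M : active D u ->
  reach (excited_move u D) (peak_move u L) n E M -> reach D L n.+1 E M.
Proof.
move=> au; elim=> [|{}n {}E {}M v _ IH av]; last exact: reachS.
by apply: reachS => //; apply: reach0.
Qed.

Lemma reach_uncons D L n E M : reach D L n.+1 E M -> exists2 u, active D u &
  reach (excited_move u D) (peak_move u L) n E M.
Proof.
elim: n E M => [|n IH] E M r; inversion r as [|n' E' M' u r' au]; subst.
  by inversion r'; subst; exists u => //; apply: reach0.
by have [v av rv] := IH _ _ r'; exists v => //; apply: reachS.
Qed.

Let beyond v u := ((v.1 < u.1) && (u.1 + v.2 == u.2 + v.1))%N.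
Let count_beyond v D := \sum_(u <- D) beyond v u.

Lemma count_beyond_move v D u : active D u ->
  count_beyond v (excited_move u D) = (count_beyond v D + (u == v))%N.
Proof.
move=> au; have uD := active_in au.
have nSE : cellSE u \notin D.
  by case/and4P: au => _ _ _; rewrite in_fsetD => /andP[].
rewrite /count_beyond /excited_move big_fsetU1 /=; last by rewrite !inE negb_and nSE orbT.
rewrite (big_fsetD1 u uD) /= addnC addnAC addnC; congr addn.
by rewrite /beyond; case: u v {au uD nSE} => [i j] [k l] /=; rewrite xpair_eqE; lia.
Qed.

Lemma count_beyond_reach v D L n E M : reach D L n E M ->
  count_beyond v D <= count_beyond v E.
Proof.
elim=> // {}n {}E {}M u _ IH au; rewrite count_beyond_move //.
exact: leq_trans IH (leq_addr _ _).
Qed.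

Lemma reach_front v D L n E M : active D v -> reach D L n E M ->
  count_beyond v D < count_beyond v E ->
  exists2 m, n = m.+1 & reach (excited_move v D) (peak_move v L) m E M.
Proof.
elim: n D L => [|n IH] D L av r lt_v.
  by inversion r; subst; rewrite ltnn in lt_v.
have [u au ru] := reach_uncons r.
have [uv|uv] := eqVneq u v; first by subst u; exists n.
have lt_v' : count_beyond v (excited_move u D) < count_beyond v E.
  by rewrite count_beyond_move // (negPf uv) addn0.
have [m -> rm] := IH _ _ (active_move au av uv) ru lt_v'.
exists m.+1 => //; rewrite eq_sym in uv; apply: (reach_cons (active_move av au uv)).
by rewrite (excited_moveC au av) 1?eq_sym // (peak_moveC _ au av) 1?eq_sym.
Qed.

Lemma reach_uniq D L n1 n2 E M1 M2 :
  reach D L n1 E M1 -> reach D L n2 E M2 -> M1 = M2.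
Proof.
elim: n1 n2 D L => [|n1 IH] n2 D L r1 r2.
  inversion r1; subst; case: n2 r2 => [|n2] r2; first by inversion r2.
  have [u au /(count_beyond_reach u)] := reach_uncons r2.
  by rewrite count_beyond_move // eqxx addn1 ltnn.
have [u au ru] := reach_uncons r1.
have := count_beyond_reach u ru; rewrite count_beyond_move // eqxx addn1 => lt_u.
by have [m _ rm] := reach_front au r2 lt_u; apply: IH ru rm.
Qed.

Lemma has_peaks_uniq D L M : has_peaks D L -> has_peaks D M -> L = M.
Proof.
have reachP N : has_peaks D N -> exists n, reach (diagram mu) fset0 n D N.
  elim=> [|{}D {}N u _ [n r] au]; first by exists 0; apply: reach0.
  by exists n.+1; apply: reachS.
by move=> /reachP[n1 r1] /reachP[n2 r2]; apply: reach_uniq r1 r2.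
Qed.

Lemma has_peaksP D : excited D -> has_peaks D (peaks D).
Proof.
move=> eD; apply: xgetPex; elim: eD => [|{}D u _ [L DL] au].
  by exists fset0; apply: has_peaks_start.
by exists (peak_move u L); apply: has_peaks_step.
Qed.

Lemma peaks_start : peaks (diagram mu) = fset0.
Proof.
by apply: has_peaks_uniq has_peaks_start; apply/has_peaksP/excited_start.
Qed.

Lemma peaks_step D u : excited D -> active D u ->
  peaks (excited_move u D) = peak_move u (peaks D).
Proof.
move=> eD au; apply: has_peaks_uniq (has_peaks_step (has_peaksP eD) au).
exact/has_peaksP/excited_step.
Qed.

Definition peak_hooks D := \sum_(u <- peaks D) hook la u.
Definition durfee_peaks D := #|` peaks D `&` durfee la|.

End ExcitedDiagrams.

(* Main.v *)
(** Give the cell u of la the weight w u = q ^ hook u * t ^ [u in Durfee square].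
    Sorting the reverse plane partitions of shape la/K by their zero set L and
    subtracting 1 off L gives Z(K) = sum_(L containing K) x(la/L) Z(L), where
    x(la/L) is q ^ |la/L| * t ^ #(diagonal cells); this determines Z from
    Z(la) = 1.  The same recursion is satisfied by the coefficients H(K) of the
    0-Hecke product of the factors 1 + (1 - w u) T_(content u), u in la, acting
    on the empty partition, up to the factor prod_(u in la) (1 - w u).

    The link is M_P(K), the Moebius transform of H over the order ideals of P
    containing K.  For P = mu, M_mu(mu) = H(mu), and unfolding the recursion of
    M_mu cell by cell enumerates the excited diagrams D of la/mu, where a factor
    w u appears exactly at the excited peaks.  For P = la one has
    M_la(K) = x(la/K) H(K), a form of the equivariant K-theoretic Chevalley
    formula: writing w (i, j) = a i / b j with labels on the boundary steps of
    la, adding a cell swaps two adjacent labels. *)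

Require Import Defs.
From mathcomp Require Import all_boot all_algebra finmap.
From mathcomp Require Import classical_sets fsbigop.
From mathcomp Require Import boolp zify ring.
Local Open Scope ring_scope.

Set Implicit Arguments.
Unset Strict Implicit.
Unset Printing Implicit Defensive.
Import GRing.Theory.

(** Unfolding the recursion of [hecke] directly also gives a sum over excited diagrams without
    signs, but not the required one. When a cell v with the content of u is removable, H(K) becomes
    w u H(K) + (1 - w u) H(K minus v), so w u sits at a position to which a cell of mu could still
    have moved; a peak is a position that it has left. For one cell in a 2 by 2 square the two
    expansions are (1 - w11) + w11 (1 - w00) and (1 - w00) + w00 (1 - w11). The transform over the
    ideals of mu shifts the factor from removable to addable cells, and leaves the value at mu alone
    because mu is the only such ideal that contains mu.

    Thus one H is transformed over two different P, and P is a parameter throughout. The recursion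
    for Z has Z(K) on both sides; it determines Z because q divides x(la/K) unless K = la. As labels
    need not be invertible, the identity for M_la(K) is proved with denominators cleared, and
    products of labels are cancelled as regular elements. *)

Definition cell_le (u v : cell) := ((u.1 <= v.1) && (u.2 <= v.2))%N.

Definition same_content (u v : cell) := (u.1 + v.2 == v.1 + u.2)%N.

Definition ideal (K : {fset cell}) : bool :=
  `[< forall u v, v \in K -> cell_le u v -> u \in K >].

Definition removable (K : {fset cell}) (v : cell) :=
  (v \in K) && ideal (K `\ v)%fset.

Definition addable (K : {fset cell}) (v : cell) :=
  (v \notin K) && ideal (v |` K)%fset.

(** Reduces facts about cells to linear arithmetic on coordinates. Quantified hypotheses,
    memberships and ideals are dropped, so every inequality to be used must already stand in the
    context or the goal. *)
Ltac cells :=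
  intros; repeat match goal with
  | H : forall _, _ |- _ => clear H
  | H : is_true (_ \in _) |- _ => clear H
  | H : is_true (ideal _) |- _ => clear H
  end;
  repeat match goal with
  | u : cell |- _ => destruct u
  | u : Choice.sort _ |- _ => destruct u
  | u : Equality.sort _ |- _ => destruct u
  end;
  unfold cell_le, same_content, cellE, cellS, cellSE in *; cbn [fst snd] in *;
  repeat match goal with
  | H : context [(_, _) == (_, _)] |- _ => rewrite xpair_eqE in H
  end; rewrite ?xpair_eqE; lia.

(** * Order ideals of cells *)

Section Ideals.
Local Open Scope fset_scope.
Implicit Types (K P : {fset cell}) (u v z : cell).

Lemma idealP K :
  reflect (forall u v, v \in K -> cell_le u v -> u \in K) (ideal K).
Proof. exact: asboolP. Qed.

Lemma ideal0 : ideal fset0.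
Proof. by apply/idealP => u v; rewrite inE. Qed.

Lemma ideal_diagram la : is_part la -> ideal (diagram la).
Proof.
case/andP => srt _; apply/idealP => u v; rewrite !in_diagram => vl /andP[u1 u2].
apply: leq_ltn_trans u2 (leq_trans vl _).
have gt : transitive geq by move=> a b c ba ac; exact: leq_trans ac ba.
case: (ltnP v.1 (size la)) => [vs|/(nth_default 0%N) -> //].
by apply: (sorted_leq_nth gt leqnn 0%N srt); rewrite ?inE // (leq_ltn_trans u1).
Qed.

Lemma removable_max K v u : removable K v -> u \in K -> cell_le v u -> u = v.
Proof.
move=> /andP[vK /idealP KD] uK vu; apply/eqP/negPn/negP => uv.
by have := KD v u; rewrite !inE uv uK eqxx => /(_ isT vu).
Qed.

Lemma addable_below K v u : addable K v -> cell_le u v -> u != v -> u \in K.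
Proof.
move=> /andP[vK /idealP KD] uv ne; have := KD u v.
by rewrite !inE eqxx (negPf ne) => /(_ isT uv).
Qed.

Lemma addableP K v : ideal K -> v \notin K ->
  (forall u, cell_le u v -> u != v -> u \in K) -> addable K v.
Proof.
move=> /idealP iK vK lo; rewrite /addable vK; apply/idealP => x y.
rewrite !inE; have [//|xv /=] := eqVneq x v.
by case/predU1P => [->|yK] xy; [apply: lo | apply: iK xy].
Qed.

Lemma removableP K v : ideal K -> v \in K ->
  (forall u, u \in K -> cell_le v u -> u = v) -> removable K v.
Proof.
move=> /idealP iK vK hi; rewrite /removable vK; apply/idealP => x y.
rewrite !inE => /andP[yv yK] xy; rewrite (iK _ _ yK xy) andbT.
by apply: contraNneq yv => xv; apply/eqP/hi => //; rewrite -xv.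
Qed.

Lemma same_content_cases u v : same_content u v ->
  [\/ u = v, cell_le (u.1.+1, u.2.+1) v | cell_le (v.1.+1, v.2.+1) u].
Proof.
move=> uv; have : (u.1 = v.1 \/ u.1 < v.1 \/ v.1 < u.1)%N by lia.
move=> [e|[e|e]]; [constructor 1|constructor 2; cells|constructor 3; cells].
by apply/eqP; cells.
Qed.

Lemma removable_uniq K v u : removable K v -> removable K u ->
  same_content u v -> u = v.
Proof.
move=> rv ru /same_content_cases[//|uv|vu].
  by apply/esym/(removable_max ru); [case/andP: rv | cells].
by apply/(removable_max rv); [case/andP: ru | cells].
Qed.

Lemma addable_uniq K v u : addable K v -> addable K u ->
  same_content u v -> u = v.
Proof.
move=> av au /same_content_cases[//|uv|vu].
  have uK : u \in K by apply: addable_below av _ _; cells.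
  by move: au; rewrite /addable uK.
have vK : v \in K by apply: addable_below au _ _; cells.
by move: av; rewrite /addable vK.
Qed.

(** If u were strictly inside v on the diagonal, the cell below u would be in K, and u would not be
    removable; if v were strictly inside u, v itself would be in K. So in a step of [mobius] on an
    ideal at most one of the two sums is nonzero. *)
Lemma addable_removable K v u : ideal K -> addable K v -> removable K u ->
  same_content u v = false.
Proof.
move=> iK av ru; apply/negP => /same_content_cases[uv|uv|vu].
- by move: av ru; rewrite uv /addable /removable => /andP[/negPf ->].
- have inK : (u.1.+1, u.2) \in K by apply: addable_below av _ _; cells.
  have le : cell_le u (u.1.+1, u.2) by cells.
  by have := removable_max ru inK le; case: (u) => a b [] /eqP; rewrite gtn_eqF.
- have vK : v \in K by move/idealP: iK; apply; [case/andP: ru => + _; apply | cells].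
  by move: av; rewrite /addable vK.
Qed.

Lemma addable_fsetD1 K v : ideal K -> removable K v -> addable (K `\ v) v.
Proof.
move=> iK /andP[vK iKv]; rewrite /addable fsetD1K // iK andbT.
by rewrite !inE eqxx.
Qed.

Lemma big_fpowerset_fsetU1 (R : nmodType) P v (p : pred {fset cell})
    (F : {fset cell} -> R) : v \in P ->
  (\sum_(K <- fpowerset P | (v \in K) && p K) F K =
   \sum_(K <- fpowerset P | (v \notin K) && p (v |` K)) F (v |` K))%R.
Proof.
move=> vP; rewrite -big_filter -[RHS](big_filter _ (fun K => (v \notin K) && p (v |` K))).
rewrite -(big_map (fun K => v |` K) xpredT F); apply: perm_big; apply: uniq_perm.
- exact/filter_uniq/fset_uniq.
- rewrite map_inj_in_uniq; first exact/filter_uniq/fset_uniq.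
  move=> A B; rewrite !mem_filter => /andP[/andP[vA _] _] /andP[/andP[vB _] _] AB.
  by rewrite -(fsetU1K vA) AB fsetU1K.
move=> K; rewrite mem_filter fpowersetE; apply/idP/mapP => /=.
  case/andP=> /andP[vK pK] KP; exists (K `\ v); rewrite ?fsetD1K //.
  rewrite mem_filter fpowersetE fsetD1K // pK !inE eqxx /=.
  exact: fsubset_trans (fsubD1set _ _) KP.
case=> A; rewrite mem_filter fpowersetE => /andP[/andP[vA pA] AP] ->.
by rewrite fset1U1 pA fsubUset fsub1set vP AP.
Qed.

End Ideals.

(** * Hecke coefficients and their Moebius transform *)

Section Recursion.
Local Open Scope ring_scope.
Variables (R : comNzRingType) (w : cell -> R).
Implicit Types (K P : {fset cell}) (u v z : cell) (s : seq cell).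

(* The coefficient of K in the product over s, outermost cell first, of the
   operators 1 + (1 - w u) T_c with c the content of u.  T_c adds the cell of
   content c to a partition, is -1 if such a cell can be removed, and is 0
   otherwise.  Both sums have at most one term. *)
Fixpoint hecke s K : R :=
  if s is u :: s' then
    hecke s' K + \sum_(v <- K | removable K v && same_content u v)
      (1 - w u) * (hecke s' (K `\ v)%fset - hecke s' K)
  else (K == fset0)%:R.

(** The recursion obeyed by the transform of [hecke] over the ideals contained in [P]. An addable
    cell of [P] with the content of u multiplies the coefficient by w u, since 1 - (1 - w u) = w u;
    a removable one adds (1 - w u) times the coefficient of the smaller ideal. *)
Fixpoint mobius P s K : R :=
  if s is u :: s' then
    mobius P s' K
    - \sum_(v <- P | addable K v && same_content u v) (1 - w u) * mobius P s' K
    + \sum_(v <- K | removable K v && same_content u v)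
        (1 - w u) * mobius P s' (K `\ v)%fset
  else (K == fset0)%:R.

Lemma big_fset_widen (T : choiceType) (A B : {fset T}) (p : pred T) (F : T -> R) :
  (A `<=` B)%fset -> (forall x, p x -> x \in A) ->
  \sum_(x <- A | p x) F x = \sum_(x <- B | p x) F x.
Proof.
move=> AB pA; rewrite -big_filter -[RHS]big_filter; apply: perm_big.
apply: uniq_perm; rewrite ?filter_uniq ?fset_uniq // => x; rewrite !mem_filter.
by case px: (p x) => //=; rewrite (fsubsetP AB) pA.
Qed.

(** Sum the recursion of [mobius] over the ideals L containing K, writing L minus v as L in the last
    term. For each v there remains a difference of two sums over ideals L to which v is addable:
    those with K inside L plus v, and those with K inside L. The two conditions agree unless v is
    removable from K. In that case the second is impossible, and the first selects the ideals that
    contain K minus v but not v, whose sum is H(K minus v) - H(K). *)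
Lemma hecke_mobius P s K : ideal K -> (K `<=` P)%fset ->
  hecke s K =
  \sum_(L <- fpowerset P | ideal L && (K `<=` L)%fset) mobius P s L.
Proof.
elim: s K => [|u s IH] K iK KP /=.
  rewrite big_mkcond (big_fsetD1 fset0) /=; last by rewrite fpowersetE fsub0set.
  rewrite ideal0 fsubset0 big1_seq ?addr0; first by case: (K == _).
  by move=> L; rewrite !inE => /andP[_ /andP[/negPf -> _]]; case: ifP.
pose T v (p : pred {fset cell}) :=
  \sum_(L <- fpowerset P | [&& addable L v, ideal L & p L]) mobius P s L.
have add_part : \sum_(L <- fpowerset P | ideal L && (K `<=` L)%fset)
    \sum_(v <- P | addable L v && same_content u v) (1 - w u) * mobius P s L =
  \sum_(v <- P | same_content u v) (1 - w u) * T v (fun L => K `<=` L)%fset.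
  rewrite (exchange_big_dep (same_content u)) /=; last by move=> ? ? _ /andP[].
  apply: eq_bigr => v uv; rewrite mulr_sumr; apply: eq_bigl => L.
  by rewrite uv andbT andbC.
have rem_part : \sum_(L <- fpowerset P | ideal L && (K `<=` L)%fset)
    \sum_(v <- L | removable L v && same_content u v)
       (1 - w u) * mobius P s (L `\ v)%fset =
  \sum_(v <- P | same_content u v) (1 - w u) * T v (fun L => K `<=` v |` L)%fset.
  transitivity (\sum_(L <- fpowerset P | ideal L && (K `<=` L)%fset)
    \sum_(v <- P | removable L v && same_content u v)
       (1 - w u) * mobius P s (L `\ v)%fset).
    rewrite big_seq_cond [RHS]big_seq_cond; apply: eq_bigr => L.
    rewrite fpowersetE => /andP[LP _]; apply: big_fset_widen => // v.
    by case/andP=> /andP[].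
  rewrite (exchange_big_dep (same_content u)) /=; last by move=> ? ? _ /andP[].
  rewrite big_seq_cond [RHS]big_seq_cond; apply: eq_bigr => v /andP[vP uv].
  transitivity (\sum_(L <- fpowerset P |
      (v \in L) && [&& ideal (L `\ v), ideal L & K `<=` L]%fset)
      (1 - w u) * mobius P s (L `\ v)%fset).
    apply: eq_bigl => L; rewrite /removable uv andbT.
    by case: (v \in L); case: (ideal L); case: (ideal _); case: (_ `<=` _)%fset.
  rewrite big_fpowerset_fsetU1 // mulr_sumr; apply: eq_big => [L|L /and3P[vL _ _]].
    rewrite /addable; case vL: (v \in L) => //=; rewrite fsetU1K ?vL //.
    by rewrite andbCA.
  by rewrite fsetU1K.
rewrite big_split sumrB /= add_part rem_part -IH // -addrA; congr (_ + _).
rewrite addrC -sumrB (big_fset_widen _ KP); last by move=> v /andP[/andP[]].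
rewrite big_mkcondl [RHS]big_seq_cond [LHS]big_seq_cond.
apply: eq_bigr => v /andP[vP uv]; rewrite -mulrBr /T.
case: (boolP (removable K v)) => [rv|nrv].
  congr (_ * _); have [vK iKv] := andP rv.
  have sKv : (K `\ v `<=` P)%fset by apply: fsubset_trans KP; exact: fsubD1set.
  rewrite [X in _ = _ - X]big1 ?subr0; last first.
    by move=> L /and3P[/andP[/negP vL _] _ /fsubsetP KL]; case: vL; apply: KL.
  apply/eqP; rewrite subr_eq; apply/eqP.
  rewrite (IH (K `\ v)%fset) // (IH K) //.
  rewrite (bigID (fun L => v \notin L)) /=; congr (_ + _); apply: eq_bigl => L.
    rewrite fsubDset /addable; case: (boolP (ideal L)) => [iL|_]; last first.
      by rewrite /= !andbF.
    case vL: (v \in L); rewrite ?andbF ?andbT //=.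
    case sub: (K `<=` _)%fset; rewrite ?andbF // andbT.
    apply/esym; suff /andP[] : addable L v by [].
    apply: addableP => //; first by rewrite vL.
    move=> z zv ne; have /(fsubsetP sub) : z \in K.
      by move/idealP: iK; apply; eassumption.
    by rewrite !inE (negPf ne).
  rewrite negbK fsubDset; case: (boolP (ideal L)) => //= _.
  case vL: (v \in L); rewrite ?andbT ?andbF.
    by congr (_ `<=` _)%fset; apply/fsetP => z; rewrite !inE; case: eqVneq => // ->.
  by apply/esym/negP => /fsubsetP/(_ v vK); rewrite vL.
rewrite [X in _ = _ * (X - _)](eq_bigl (fun L => [&& addable L v, ideal L & (K `<=` L)%fset])).
  by rewrite subrr mulr0.
move=> L; case: (boolP (addable L v)) => //= /andP[vL _].
case: (boolP (ideal L)) => //= iL; apply/idP/idP => [sub|]; last first.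
  by move/fsubset_trans; apply; exact: fsubsetUr.
apply/fsubsetP => z zK; have := fsubsetP sub z zK; rewrite !inE => /predU1P[zv|//].
case/negP: nrv; apply: removableP => //; first by rewrite -zv.
move=> x xK vx; apply/eqP/negPn/negP => ne; have := fsubsetP sub x xK.
rewrite !inE (negPf ne) /= => xL; case/negP: vL.
by move/idealP: iL; apply; eassumption.
Qed.

(** * Evaluation of the one-term sums, and supports of the coefficients *)

Lemma same_content_trans u v z :
  same_content u v -> same_content u z -> same_content v z.
Proof. by cells. Qed.

Lemma sum_removable K u v (F : cell -> R) : removable K v -> same_content u v ->
  \sum_(x <- K | removable K x && same_content u x) F x = F v.
Proof.
move=> rv uv; have vK : v \in K by case/andP: rv.
rewrite big_mkcond (big_fsetD1 v) //= rv uv /= big1_fset ?addr0 // => x.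
rewrite !inE => /andP[/eqP ne _] _; case: ifP => // /andP[rx ux]; case: ne.
exact: removable_uniq rv rx (same_content_trans ux uv).
Qed.

Lemma sum_addable P K u v (F : cell -> R) : v \in P -> addable K v ->
  same_content u v ->
  \sum_(x <- P | addable K x && same_content u x) F x = F v.
Proof.
move=> vP av uv; rewrite big_mkcond (big_fsetD1 v) //= av uv /= big1_fset ?addr0 // => x.
rewrite !inE => /andP[/eqP ne _] _; case: ifP => // /andP[ax ux]; case: ne.
exact: addable_uniq av ax (same_content_trans ux uv).
Qed.

Lemma sum_no_addable P K u (F : cell -> R) :
  (forall v, v \in P -> addable K v -> same_content u v = false) ->
  \sum_(x <- P | addable K x && same_content u x) F x = 0.
Proof.
by move=> no; rewrite big1_fset // => x xP /andP[ax]; rewrite (no x).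
Qed.

Lemma sum_no_removable K u (F : cell -> R) :
  (forall v, removable K v -> same_content u v = false) ->
  \sum_(x <- K | removable K x && same_content u x) F x = 0.
Proof.
by move=> no; rewrite big1_fset // => x xK /andP[rx]; rewrite no.
Qed.

(* s lists the cells of an order ideal from the outside in. *)
Fixpoint linext s : Prop :=
  if s is u :: s' then
    [/\ u \notin s', forall z, cell_le z u -> z != u -> z \in s' & linext s']
  else True.

Lemma linext_down s u v : linext s -> v \in s -> cell_le u v -> u \in s.
Proof.
elim: s => //= x s IH [xs lo ls]; rewrite !inE => /predU1P[->|vs] uv.
  by case: eqVneq => //= ne; apply: lo.
by rewrite (IH ls vs uv) orbT.
Qed.

Lemma linext_max s u v : linext (u :: s) -> cell_le u v -> v \notin s.
Proof.
move=> [us lo ls] uv; apply: contra us => vs; exact: linext_down ls vs uv.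
Qed.

Lemma linext_removable u s K v : linext (u :: s) -> ideal K ->
  removable K v -> same_content u v -> {subset (K `\ v)%fset <= s} ->
  {subset K <= u :: s}.
Proof.
move=> lus iK rv uv sub z zK; have [us lo ls] := lus.
rewrite inE; case: (eqVneq z v) => [->|ne]; last first.
  by rewrite (sub z) ?orbT // !inE ne.
have vK : v \in K by case/andP: rv.
case: (same_content_cases uv) => [->|lt|lt]; first by rewrite eqxx.
  have uK : u \in (K `\ v)%fset.
    rewrite !inE; apply/andP; split; first by cells.
    by move/idealP: iK; apply; [exact: vK | cells].
  by rewrite (sub u uK) in us.
by rewrite lo ?orbT //; cells.
Qed.

(** A step for u adds one cell v of the same content. If the rest of K lies in s, then v is u or a
    cell further in on that diagonal, which s already contains; so no K outside the listed cells is
    ever reached. *)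
Lemma recursion_support P s K : linext s -> ideal K -> ~ {subset K <= s} ->
  hecke s K = 0 /\ mobius P s K = 0.
Proof.
elim: s K => [|u s IH] K /=.
  move=> _ _ sub; suff /negPf-> : K != fset0 by [].
  by apply/eqP => K0; apply: sub => x; rewrite K0.
move=> lus iK nsub; have [us lo ls] := lus.
have nsub1 : ~ {subset K <= s}.
  by move=> sub; apply: nsub => x /sub xs; rewrite inE xs orbT.
have [-> ->] := IH K ls iK nsub1.
have rem0 v : removable K v && same_content u v ->
    hecke s (K `\ v)%fset = 0 /\ mobius P s (K `\ v)%fset = 0.
  move=> /andP[rv uv]; apply: IH => //; first by case/andP: rv.
  by move=> sub; apply: nsub; apply: linext_removable uv _.
rewrite !big1 ?subr0 ?add0r //.
- by move=> v /rem0[_ ->]; rewrite mulr0.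
- by move=> v _; rewrite mulr0.
- by move=> v /rem0[-> _]; rewrite subrr mulr0.
Qed.

Lemma linext_exists K : ideal K -> exists2 s, linext s & s =i K.
Proof.
elim: {K}_.+1 {-2}K (ltnSn #|` K|) => // n IH K.
have [->|[x xK]] := fset_0Vmem K; first by exists [::].
move=> cK iK.
have [v vK vmax] : exists2 v : cell, v \in K &
    forall u : cell, u \in K -> (u.1 + u.2 <= v.1 + v.2)%N.
  have := @arg_maxnP K [` xK]%fset xpredT (fun v : K => (val v).1 + (val v).2)%N isT.
  case=> v _ vmax; exists (val v); first exact: fsvalP.
  by move=> u uK; have := vmax [` uK]%fset isT.
have rv : removable K v.
  apply: removableP => // u uK vu; have := vmax u uK => le.
  by apply/eqP; move: vu le; clear; cells.
have [_ iKv] := andP rv.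
have [||s ls sK] := IH (K `\ v)%fset; rewrite //.
  by have := cardfsD1 (v) K; rewrite vK; lia.
exists (v :: s) => /=; last first.
  move=> z; rewrite inE sK !inE; case: eqVneq => // ->; by rewrite vK.
split=> //; first by rewrite sK !inE eqxx.
move=> z zv ne; rewrite sK !inE ne /=.
by move/idealP: iK; apply; eassumption.
Qed.
End Recursion.

(** * The Chevalley formula *)

Section RowLengths.
Variables (N B : nat).
Implicit Types (K P : {fset cell}) (u v z : cell) (s : seq cell) (p : pred cell).

Definition row_len p i := (\sum_(j < B) p (i, nat_of_ord j))%N.
Definition col_len p j := (\sum_(i < N) p (nat_of_ord i, j))%N.

Lemma sum_initial_segment M (f : pred nat) k :
  (forall i j, (i <= j)%N -> f j -> f i) ->
  (k < \sum_(i < M) f i)%N = (k < M)%N && f k.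
Proof.
move=> down; elim: M k => [|M IH] k; first by rewrite big_ord0 ltn0.
rewrite big_ord_recr /=; case fM: (f M).
  rewrite (eq_bigr (fun=> 1%N)) => [|i _]; last by rewrite (down i M) // ltnW.
  rewrite sum1_card card_ord addn1; case: ltnP => //= kM.
  by rewrite (down k M).
rewrite addn0 IH; case: (eqVneq k M) => [->|ne]; first by rewrite fM !andbF.
by congr (_ && _); lia.
Qed.

Definition in_box (p : pred cell) := forall v, p v -> (v.1 < N)%N /\ (v.2 < B)%N.
Definition down_closed (p : pred cell) := forall u v, p v -> cell_le u v -> p u.

Lemma row_lenE p i j : down_closed p -> in_box p ->
  (j < row_len p i)%N = p (i, j).
Proof.
move=> dp bp; rewrite /row_len (sum_initial_segment B (f := fun j => p (i, j))).
  by case pij: (p (i, j)); rewrite ?andbF // andbT; case: (bp _ pij).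
by move=> j1 j2 le pj; apply: dp pj _; cells.
Qed.

Lemma col_lenE p i j : down_closed p -> in_box p ->
  (i < col_len p j)%N = p (i, j).
Proof.
move=> dp bp; rewrite /col_len (sum_initial_segment N (f := fun i => p (i, j))).
  by case pij: (p (i, j)); rewrite ?andbF // andbT; case: (bp _ pij).
by move=> j1 j2 le pj; apply: dp pj _; cells.
Qed.

(** Number the N + B boundary steps of the shape from 1, starting at the bottom left. This is the
    number of the vertical step that ends row i; the horizontal step that ends column j has number N
    + j.+1 - [col_len] j. *)
Definition row_pos p i := (N + row_len p i - i)%N.

Lemma row_pos_decr p i k : down_closed p -> in_box p -> (i < k)%N -> (k < N)%N ->
  (row_pos p k < row_pos p i)%N.
Proof.
move=> dp bp ik kN; rewrite /row_pos.
suff : (row_len p k <= row_len p i)%N by lia.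
rewrite leqNgt row_lenE //; apply/negP => h.
have : p (i, row_len p i) by apply: dp h _; cells.
by rewrite -row_lenE // ltnn.
Qed.

Lemma ideal_down K : ideal K -> down_closed (mem K).
Proof. by move/idealP => iK u v vK uv; apply: iK vK uv. Qed.

(** At an addable cell the vertical step of row v.1, at position c = N + v.2 - v.1, is followed by a
    horizontal step at c.+1, so that no other row can end at either position. *)
Lemma addable_row K v i : ideal K -> in_box (mem K) -> addable K v ->
  (v.1 < N)%N -> (i < N)%N ->
  if i == v.1 then row_pos (mem K) i = (N + v.2 - v.1)%N
  else (row_pos (mem K) i != (N + v.2 - v.1)%N) &&
       (row_pos (mem K) i != (N + v.2 - v.1).+1).
Proof.
move=> iK bK av vN iN; have dK := ideal_down iK; have vK : v \notin K by case/andP: av.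
have lenE j k : (k < row_len (mem K) j)%N = ((j, k) \in K) by rewrite row_lenE.
rewrite /row_pos; case: eqVneq => [->|ne].
  have : (row_len (mem K) v.1 <= v.2)%N by rewrite leqNgt lenE -surjective_pairing.
  rewrite leq_eqVlt => /predU1P[-> //|lt].
  have : (v.1, row_len (mem K) v.1) \in K by apply: (addable_below av); cells.
  by rewrite -lenE ltnn.
case: (ltnP i v.1) => [iv|vi0].
  have : (v.2 < row_len (mem K) i)%N by rewrite lenE; apply: (addable_below av); cells.
  lia.
have vi : (v.1 < i)%N by lia.
have : (row_len (mem K) i <= v.2)%N.
  rewrite leqNgt lenE; apply: contra vK => h.
  by apply: (dK _ _ h); cells.
lia.
Qed.

Lemma row_len_fsetD1 K v i : i != v.1 ->
  row_len (mem (K `\ v)%fset) i = row_len (mem K) i.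
Proof.
move=> ne; apply: eq_bigr => j _; congr nat_of_bool.
by rewrite /= !inE; case: eqVneq => // e; move: ne; rewrite -e eqxx.
Qed.

Lemma removable_row K v : ideal K -> in_box (mem K) -> removable K v ->
  row_pos (mem K) v.1 = (N + v.2 - v.1).+1.
Proof.
move=> iK bK rv; have dK := ideal_down iK.
have [vK _] := andP rv; have [vN _] := bK _ vK.
have lenE j k : (k < row_len (mem K) j)%N = ((j, k) \in K) by rewrite row_lenE.
have : (v.2 < row_len (mem K) v.1)%N by rewrite lenE -surjective_pairing.
have : (row_len (mem K) v.1 <= v.2.+1)%N.
  rewrite leqNgt lenE; apply/negP => h.
  have le : cell_le v (v.1, v.2.+1) by cells.
  by have := removable_max rv h le; case: (v) => x y [] /eqP; rewrite gtn_eqF.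
by rewrite /row_pos; lia.
Qed.

End RowLengths.

Section Swap.
Variable R : comNzRingType.
Implicit Types (y : nat -> R).

Definition swap c y : nat -> R :=
  fun k => if k == c then y c.+1 else if k == c.+1 then y c else y k.

Lemma swap_id c y k : k != c -> k != c.+1 -> swap c y k = y k.
Proof. by rewrite /swap => /negPf-> /negPf->. Qed.

Lemma swapL c y : swap c y c = y c.+1.
Proof. by rewrite /swap eqxx. Qed.

Lemma swapR c y : swap c y c.+1 = y c.
Proof. by rewrite /swap eqxx gtn_eqF. Qed.

(** Strict monotonicity makes f injective: if c and c.+1 are taken, then once each, and the swap
    only exchanges two factors. *)
Lemma prod_swap N (f : nat -> nat) c y :
  (forall i k, (i < k)%N -> (k < N)%N -> (f k < f i)%N) ->
  ((exists i, [/\ (i.+1 < N)%N, f i = c.+1 & f i.+1 = c]) \/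
   forall i, (i < N)%N -> f i != c /\ f i != c.+1) ->
  \prod_(i < N) y (f i) = \prod_(i < N) swap c y (f i).
Proof.
move=> mono [[i [iN fi fi1]]|out]; last first.
  by apply: eq_bigr => i _; have [n1 n2] := out i (ltn_ord i); rewrite swap_id.
pose i0 := Ordinal (ltnW iN); pose i1 := Ordinal iN.
have ne : i1 != i0 by rewrite -val_eqE /= gtn_eqF.
rewrite (bigD1 i0) // (bigD1 i1) //= [RHS](bigD1 i0) // (bigD1 i1) //=.
rewrite fi fi1 swapL swapR !mulrA [y c.+1 * _]mulrC; congr (_ * _).
apply: eq_bigr => k /andP[k0 k1]; rewrite swap_id //.
  case: (ltngtP k i) => [ki|ik|e]; last by move: k0; rewrite -val_eqE /= e eqxx.
    by have := mono k i ki (ltnW iN); lia.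
  have ik' : (i.+1 < k)%N by move: k1; rewrite -val_eqE /=; lia.
  by have := mono _ k ik' (ltn_ord k); lia.
case: (ltngtP k i) => [ki|ik|e]; last by move: k0; rewrite -val_eqE /= e eqxx.
  by have := mono k i ki (ltnW iN); lia.
by have := mono i k ik (ltn_ord k); lia.
Qed.

End Swap.

Section Chevalley.
Variables (N B : nat).
Implicit Types (K P : {fset cell}) (u v z : cell) (s : seq cell).
Local Notation len K := (row_len B (mem K)).
Local Notation pos K := (row_pos N B (mem K)).

(** Steps c and c.+1 of different direction would form a corner, hence an addable or a removable
    cell of the content of u. So both are vertical, ending consecutive rows, or both are
    horizontal. *)
Lemma row_pos_neutral K u : ideal K -> in_box N B (mem K) -> (u.1 < N)%N ->
  (forall v, addable K v -> same_content u v = false) ->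
  (forall v, removable K v -> same_content u v = false) ->
  let c := (N + u.2 - u.1)%N in
  (exists i, [/\ (i.+1 < N)%N, pos K i = c.+1 & pos K i.+1 = c]) \/
  forall i, (i < N)%N -> pos K i != c /\ pos K i != c.+1.
Proof.
move=> iK bK uN noadd norem c; have cE : c = (N + u.2 - u.1)%N by [].
clearbody c; have dK := ideal_down iK.
have lenE j k : (k < len K j)%N = ((j, k) \in K) by rewrite (row_lenE _ _ dK bK).
have len_decr i k : (i <= k)%N -> (len K k <= len K i)%N.
  move=> ik; rewrite leqNgt lenE; apply/negP => h.
  suff : (i, len K i) \in K by rewrite -lenE ltnn.
  by apply: dK h _; cells.
case: (pselect (exists2 i, (i < N)%N & pos K i = c \/ pos K i = c.+1)); last first.
  move=> no; right=> i iN; split; apply/eqP => e; apply: no; exists i => //.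
    by left.
  by right.
move=> [i iN fi]; left; case: fi => fi; rewrite /row_pos in fi *.
  case: i iN fi => [|i] iN fi.
    have av : addable K (0%N, len K 0%N).
      apply: addableP => //; first by rewrite -lenE ltnn.
      move=> [x z] le ne; rewrite -lenE; move: le ne.
      by rewrite /cell_le xpair_eqE /=; case: x => //=; lia.
    by have := noadd _ av; rewrite /same_content; cbn [fst snd] => h; exfalso; lia.
  case: (ltngtP (len K i) (len K i.+1)) => [lt|lt|e].
  - by have h := len_decr i i.+1 (leqnSn i); exfalso; lia.
  - have av : addable K (i.+1, len K i.+1).
      apply: addableP => //; first by rewrite -lenE ltnn.
      move=> [x z] le ne; rewrite -lenE.
      have [xi|xi] := leqP x i; first by have := len_decr x i xi; move: le; cells.
      have -> : x = i.+1 by move: le; cells.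
      by move: le ne; cells.
    by have := noadd _ av; rewrite /same_content; cbn [fst snd] => h; exfalso; lia.
  - by exists i; split => //; lia.
case len0: (len K i) => [|l].
  (* As u.1 < N, c is positive, so an empty row that ends at c.+1 is not the last row. *)
  have iN1 : (i.+1 < N)%N by lia.
  by exists i; split=> //; have := len_decr i i.+1 (leqnSn i); lia.
case: (ltnP i.+1 N) => iN1; last first.
  have rv : removable K (i, l).
    apply: removableP => //; first by rewrite -lenE len0.
    move=> [x z] xK le; have [/= xN _] := bK _ xK; apply/eqP.
    have xi : x = i by move: le; cells.
    by move: xK; rewrite xi -lenE len0; move: le; cells.
  by have := norem _ rv; rewrite /same_content; cbn [fst snd] => h; exfalso; lia.
case: (ltngtP (len K i.+1) l.+1) => [lt|lt|e].
- have rv : removable K (i, l).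
    apply: removableP => //; first by rewrite -lenE len0.
    move=> [x z] xK le; apply/eqP.
    have : (z < len K x)%N by rewrite lenE.
    have [xi|xi] := ltnP i x; first by have := len_decr i.+1 x xi; move: le; cells.
    have -> : x = i by move: le; cells.
    by rewrite len0; move: le; cells.
  by have := norem _ rv; rewrite /same_content; cbn [fst snd] => h; exfalso; lia.
- by have h := len_decr i i.+1 (leqnSn i); exfalso; lia.
- by exists i; split=> //; lia.
Qed.

Variables (R : comNzRingType) (w : cell -> R).

Definition row_prod (y : nat -> R) K := \prod_(i < N) y (pos K i).

Lemma row_prodD1 y K i : (i < N)%N ->
  row_prod y K = y (pos K i) * \prod_(k < N | k != i :> nat) y (pos K k).
Proof. by move=> iN; rewrite /row_prod (bigD1 (Ordinal iN)). Qed.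

(** The outermost cell u is a corner: row u.1 ends at c.+1 and column u.2 at c. Removing u exchanges
    these two positions, so after exchanging the two labels every row and column still carries its
    own label. *)
Lemma linext_labels u s (a b y : nat -> R) :
  linext (u :: s) -> in_box N B (mem (u :: s)) ->
  (forall i, (i < N)%N -> y (pos (u :: s) i) = a i) ->
  (forall j, (j < B)%N -> y (N + j.+1 - col_len N (mem (u :: s)) j)%N = b j) ->
  let c := (N + u.2 - u.1)%N in
  [/\ y c.+1 = a u.1, y c = b u.2,
    forall i, (i < N)%N -> swap c y (pos s i) = a i &
    forall j, (j < B)%N -> swap c y (N + j.+1 - col_len N (mem s) j)%N = b j].
Proof.
move=> lus bus ya yb c; have cE : c = (N + u.2 - u.1)%N by [].
clearbody c; have [us lo ls] := lus.
have [uN uB] : (u.1 < N)%N /\ (u.2 < B)%N by apply: bus; rewrite /= inE eqxx.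
have ds : down_closed (mem s) by move=> v z; exact: linext_down ls.
have bs : in_box N B (mem s) by move=> v /= vs; apply: bus; rewrite /= inE vs orbT.
have dus : down_closed (mem (u :: s)) by move=> v z; exact: linext_down lus.
have lenE j k : (k < len s j)%N = ((j, k) \in s) by rewrite (row_lenE _ _ ds bs).
have clenE j k : (k < col_len N (mem s) j)%N = ((k, j) \in s)
  by rewrite (col_lenE _ _ ds bs).
have lenE' j k : (k < len (u :: s) j)%N = ((j, k) == u) || (k < len s j)%N.
  by rewrite (row_lenE _ _ dus bus) lenE.
have clenE' j k : (k < col_len N (mem (u :: s)) j)%N =
    ((k, j) == u) || (k < col_len N (mem s) j)%N.
  by rewrite (col_lenE _ _ dus bus) clenE.
have eq_len m n : (forall k, (k < m)%N = (k < n)%N) -> m = n.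
  by move=> h; have := h m; have := h n; lia.
have len_u : len s u.1 = u.2.
  apply: eq_len => k; rewrite lenE; apply/idP/idP => [ks|lt].
    rewrite ltnNge; apply/negP => le.
    have : (u.1, k) \notin s by apply: linext_max lus _; cells.
    by rewrite ks.
  by apply: lo; cells.
have clen_u : col_len N (mem s) u.2 = u.1.
  apply: eq_len => k; rewrite clenE; apply/idP/idP => [ks|lt].
    rewrite ltnNge; apply/negP => le.
    have : (k, u.2) \notin s by apply: linext_max lus _; cells.
    by rewrite ks.
  by apply: lo; cells.
have len_other i : i != u.1 -> len (u :: s) i = len s i.
  by move=> ne; apply: eq_len => k; rewrite lenE'; case: eqVneq => // e; move: ne; rewrite -e eqxx.
have clen_other j : j != u.2 -> col_len N (mem (u :: s)) j = col_len N (mem s) j.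
  by move=> ne; apply: eq_len => k; rewrite clenE'; case: eqVneq => // e; move: ne; rewrite -e eqxx.
have len_u' : len (u :: s) u.1 = u.2.+1.
  by apply: eq_len => k; rewrite lenE' len_u; cells.
have clen_u' : col_len N (mem (u :: s)) u.2 = u.1.+1.
  by apply: eq_len => k; rewrite clenE' clen_u; cells.
have yc1 : y c.+1 = a u.1.
  by rewrite -ya // /row_pos len_u'; congr y; lia.
have yc : y c = b u.2.
  by rewrite -yb // clen_u'; congr y; lia.
split=> //.
  move=> i iN; have [->|ne] := eqVneq i u.1; first by rewrite /row_pos len_u -cE swapL.
  rewrite -ya // /row_pos len_other //.
  have [iu|ui] := ltnP i u.1.
    have : (u.2 < len s i)%N by rewrite lenE; apply: lo; cells.
    by move=> h; rewrite swap_id //; lia.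
  have : (len s i <= u.2)%N.
    by rewrite leqNgt lenE; apply: linext_max lus _; cells.
  by move=> h; rewrite swap_id //; lia.
move=> j jB; have [->|ne] := eqVneq j u.2.
  have -> : (N + u.2.+1 - col_len N (mem s) u.2 = c.+1)%N by lia.
  by rewrite swapR.
rewrite -yb // clen_other //.
have [ju|uj] := ltnP j u.2.
  have : (u.1 < col_len N (mem s) j)%N by rewrite clenE; apply: lo; cells.
  by move=> h; rewrite swap_id //; lia.
have : (col_len N (mem s) j <= u.1)%N.
  by rewrite leqNgt clenE; apply: linext_max lus _; cells.
by move=> h; rewrite swap_id //; lia.
Qed.

(* Denominator-free form of M_la(K) = x(la/K) H(K), to allow an induction on s
   in which the labels y are permuted. *)
Lemma mobius_hecke P s (a b y : nat -> R) :
  ideal P -> in_box N B (mem P) -> linext s -> {subset s <= P} ->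
  {in s, forall v, w v * b v.2 = a v.1} ->
  (forall i, (i < N)%N -> y (pos s i) = a i) ->
  (forall j, (j < B)%N -> y (N + j.+1 - col_len N (mem s) j)%N = b j) ->
  forall K, ideal K -> (K `<=` P)%fset ->
  row_prod y K * mobius w P s K = (\prod_(i < N) a i) * hecke w s K.
Proof.
move=> iP bP; elim: s y => [|u s IH] y.
  move=> _ _ _ ya _ K _ _ /=; case: eqVneq => [->|]; last by rewrite !mulr0.
  rewrite !mulr1; apply: eq_bigr => i _; rewrite -ya //; congr (y _).
move=> lus sub wab ya yb K iK KP; have [us lo ls] := lus.
have bus : in_box N B (mem (u :: s)) by move=> v /sub /bP.
have uP : u \in P by apply: sub; rewrite inE eqxx.
have [uN uB] := bP _ uP.
have := linext_labels lus bus ya yb; set c := (N + u.2 - u.1)%N.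
move=> [yc1 yc ysa ysb].
(* The only property of the weight of u that enters: it is the ratio of the two labels about to be
   exchanged. *)
have wu : w u * y c = y c.+1 by rewrite yc yc1 wab // inE eqxx.
have {}IH L : ideal L -> (L `<=` P)%fset ->
    row_prod (swap c y) L * mobius w P s L = (\prod_(i < N) a i) * hecke w s L.
  apply: IH => // [v vs|v vs]; first by apply: sub; rewrite inE vs orbT.
  by apply: wab; rewrite inE vs orbT.
have bK : in_box N B (mem K) by move=> v vK; apply/bP/(fsubsetP KP).
rewrite /=.
(* With v removable, row v.1 ends at c.+1 in K and at c in K minus v, and all other factors agree.
   The swapped labels give y c for K and y c.+1 for K minus v, as the two terms of [hecke]
   require. *)
case: (pselect (exists2 v, removable K v & same_content u v)) => [[v rv uv]|norem].
  have [vK iKv] := andP rv; have [vN vB] := bK _ vK.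
  rewrite !(sum_removable _ rv uv) sum_no_addable ?subr0; last first.
    move=> x _ ax; apply/negP => ux; have := addable_removable iK ax rv.
    by rewrite (same_content_trans uv ux).
  have KvP : (K `\ v `<=` P)%fset by apply: fsubset_trans KP; exact: fsubD1set.
  have cv : (N + v.2 - v.1 = c)%N by rewrite /c; move: uv; cells.
  have av := addable_fsetD1 iK rv.
  have bKv : in_box N B (mem (K `\ v)%fset).
    by move=> x /= xKv; apply/bP/(fsubsetP KvP).
  have := addable_row iKv bKv av vN vN; rewrite eqxx cv => posv'.
  have posv := removable_row iK bK rv; rewrite cv in posv.
  pose Q := \prod_(k < N | k != v.1 :> nat) y (pos K k).
  have E1 : row_prod y K = y c.+1 * Q by rewrite (row_prodD1 _ _ vN) posv.
  have out k : (k < N)%N -> k != v.1 -> swap c y (pos K k) = y (pos K k).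
    move=> kN ne; have := addable_row iKv bKv av vN kN; rewrite (negPf ne) cv.
    by rewrite /row_pos row_len_fsetD1 // => /andP[n1 n2]; rewrite swap_id.
  have E2 : row_prod (swap c y) K = y c * Q.
    rewrite (row_prodD1 _ _ vN) posv swapR; congr (_ * _); apply: eq_bigr => k ne.
    exact: out.
  have E3 : row_prod (swap c y) (K `\ v)%fset = y c.+1 * Q.
    rewrite (row_prodD1 _ _ vN) posv' swapL; congr (_ * _); apply: eq_bigr => k ne.
    by rewrite -(out k) // /row_pos row_len_fsetD1.
  have H1 := IH K iK KP; have H2 := IH _ iKv KvP; rewrite E2 in H1; rewrite E3 in H2.
  rewrite E1 mulrDr mulrCA H2 -wu -[w u * y c * Q]mulrA -[_ * _ * mobius _ _ _ _]mulrA H1.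
  by ring.
rewrite [in RHS]sum_no_removable ?addr0; last first.
  by move=> v rv; apply/negP => uv; apply: norem; exists v.
rewrite sum_no_removable ?addr0; last first.
  by move=> v rv; apply/negP => uv; apply: norem; exists v.
case: (pselect (exists2 v, addable K v & same_content u v)) => [[v av uv]|noadd].
  case: (boolP (v \in P)) => [vP|vP].
    have [vN vB] := bP _ vP.
    have cv : (N + v.2 - v.1 = c)%N by rewrite /c; move: uv; cells.
    (* [mobius] is multiplied by w u and [hecke] is unchanged; the swap turns the factor y c into y
       c.+1 = w u * y c. *)
    rewrite (sum_addable _ vP av uv) -IH //.
    pose Q := \prod_(k < N | k != v.1 :> nat) y (pos K k).
    have := addable_row iK bK av vN vN; rewrite eqxx cv => posv.
    have E1 : row_prod y K = y c * Q by rewrite (row_prodD1 _ _ vN) posv.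
    have E2 : row_prod (swap c y) K = y c.+1 * Q.
      rewrite (row_prodD1 _ _ vN) posv swapL; congr (_ * _); apply: eq_bigr => k ne.
      have := addable_row iK bK av vN (ltn_ord k); rewrite (negPf ne) cv.
      by move=> /andP[n1 n2]; rewrite swap_id.
    by rewrite E1 E2 -wu; ring.
  (* An addable v outside [P] lies beyond u on the diagonal, so u is in K but not in s, and both
     sides vanish. *)
  have uK : u \in K.
    case: (same_content_cases uv) => [e|lt|lt]; first by rewrite -e uP in vP.
      by apply: (addable_below av); cells.
    by case/negP: vP; move/idealP: iP; apply; [exact: uP | cells].
  have nsub : ~ {subset K <= s} by move/(_ u uK); apply/negP.
  have [-> ->] := recursion_support w P ls iK nsub.
  by rewrite big1 ?subr0 ?mulr0 // => x _; rewrite mulr0.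
rewrite sum_no_addable ?subr0; last first.
  by move=> v _ av; apply/negP => uv; apply: noadd; exists v.
(* Neither coefficient changes, so the product of labels has to be invariant under the swap. *)
rewrite -IH //; congr (_ * _); apply: prod_swap.
  by move=> i k ik kN; apply: row_pos_decr => //; exact: ideal_down.
apply: row_pos_neutral => // v hv; apply/negP => uv.
  by apply: noadd; exists v.
by apply: norem; exists v.
Qed.

End Chevalley.

(** * Excited diagrams *)

Section Tableaux.
Local Open Scope fset_scope.
Implicit Types (K P D L : {fset cell}) (u v x y z : cell) (s : seq cell).
Implicit Types (f g : cell -> nat).

Definition shift v k : cell := (v.1 + k, v.2 + k)%N.

Definition increasing P f :=
  forall u v, v \in P -> cell_le u v -> (f u <= f v)%N.

(* An excited diagram moves each cell v of mu by f v steps along its diagonal,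
   with f weakly increasing; its peaks are the positions left by v after all
   the cells above and to the left of v have stopped moving. *)
Definition shifted P f : {fset cell} := [fset shift v (f v) | v in P].

Definition is_peak P f z := exists (v : cell) (k : nat), [/\ v \in P, z = shift v k, (k < f v)%N &
  forall u, cell_le u v -> u != v -> (f u <= k)%N].

Lemma shiftedP P f z :
  reflect (exists2 v : cell, v \in P & z = shift v (f v)) (z \in shifted P f).
Proof. exact: imfsetP. Qed.

Lemma shift_eq_cases u v j k : shift u j = shift v k ->
  [\/ u = v /\ j = k,
      cell_le (u.1.+1, u.2.+1) v /\ (k < j)%N |
      cell_le (v.1.+1, v.2.+1) u /\ (j < k)%N].
Proof.
case: u v => [a b] [c d] [] e1 e2.
have : (a = c \/ a < c \/ c < a)%N by lia.
move=> [e|[e|e]]; [constructor 1|constructor 2|constructor 3].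
- by split; [congr pair; lia | lia].
- by split; [cells | lia].
- by split; [cells | lia].
Qed.

Lemma shift_inj P f u v : increasing P f -> u \in P -> v \in P ->
  shift u (f u) = shift v (f v) -> u = v.
Proof.
move=> incf uP vP /shift_eq_cases[[]//|[le lt]|[le lt]].
  by have h : (f u <= f v)%N by [apply: incf => //; cells]; lia.
by have h : (f v <= f u)%N by [apply: incf => //; cells]; lia.
Qed.

Lemma same_content_shift u v : same_content u v -> cell_le v u ->
  u = shift v (u.1 - v.1).
Proof. by move=> uv vu; apply/eqP; rewrite /shift; cells. Qed.

Lemma below_neighbor u v : cell_le u v -> u != v ->
  exists n, [/\ cell_le u n, cell_le n v, n != v &
                cell_le v (n.1.+1, n.2) || cell_le v (n.1, n.2.+1)].
Proof.
move=> uv ne; case: (ltnP u.1 v.1) => lt.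
  by exists (v.1.-1, v.2); split; cells.
by exists (v.1, v.2.-1); split; cells.
Qed.

Lemma above_neighbor u v : cell_le u v -> u != v ->
  cell_le (cellE u) v || cell_le (cellS u) v.
Proof. by cells. Qed.

(* Pairs (D, L) of a set of cells and its peaks, following the recursion of
   [mobius]: the cell u is put in D, put in L, or skipped. *)
Fixpoint configs P s K : seq ({fset cell} * {fset cell}) :=
  if s is u :: s' then
    [seq (X.1, if has (fun v => addable K v && same_content u v) P
               then u |` X.2 else X.2) | X <- configs P s' K] ++
    flatten [seq [seq (u |` X.1, X.2) | X <- configs P s' (K `\ v)]
            | v <- [seq v <- K | removable K v && same_content u v]]
  else if K == fset0 then [:: (fset0, fset0)] else [::].

Lemma filter_removable K u :
  let vs := [seq v <- K | removable K v && same_content u v] in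
  vs = [::] \/ exists2 v, vs = [:: v] & removable K v && same_content u v.
Proof.
have := filter_uniq (fun v => removable K v && same_content u v) (fset_uniq K).
have := filter_all (fun v => removable K v && same_content u v) K.
case: (filter _ _) => [|v [|v' vs]] /=; first by left.
  by rewrite andbT => h _; right; exists v.
case/and3P=> /andP[rv uv] /andP[rv' uv'] _ /andP[/negP[]].
by rewrite inE (removable_uniq rv rv' (same_content_trans uv' uv)) eqxx.
Qed.

Lemma configs_sub P s K X : X \in configs P s K ->
  {subset X.1 <= s} /\ {subset X.2 <= s}.
Proof.
elim: s K X => [|u s IH] K X /=.
  by case: ifP => //= _; rewrite inE => /eqP ->; split=> z; rewrite inE.
rewrite mem_cat => /orP[/mapP[Y /IH[s1 s2] ->] /=|/flatten_mapP[v _ /mapP[Y /IH[s1 s2] -> /=]]].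
  split=> z; first by move/s1; rewrite inE orbC => ->.
  case: ifP => _; last by move/s2; rewrite inE orbC => ->.
  by rewrite !inE => /orP[->//|/s2->]; rewrite orbT.
split=> z; last by move/s2; rewrite inE orbC => ->.
by rewrite !inE => /orP[->//|/s1->]; rewrite orbT.
Qed.

(** The set D tells which branch was taken at u: later choices lie in the rest of the list, so u is
    in D only in the second branch, and there the removed cell is unique. *)
Lemma configs_uniq P s K : linext s -> uniq [seq X.1 | X <- configs P s K].
Proof.
elim: s K => [|u s IH] K /=; first by case: ifP.
case=> us _ ls; rewrite map_cat cat_uniq -map_comp IH //=.
have [->|[v -> _]] := filter_removable K u; first by [].
rewrite /= cats0 -map_comp; apply/andP; split.
  apply/hasP => -[D /mapP[X _ ->] /= /mapP[Y /configs_sub[s1 _] /= e]].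
  by case/negP: us; apply: s1; rewrite -e /= !inE eqxx.
rewrite (map_comp (fun D => u |` D)) map_inj_in_uniq ?IH //.
move=> D D' /mapP[X /configs_sub[s1 _] ->] /mapP[Y /configs_sub[s2 _] ->] e.
rewrite -(fsetU1K (contra (s1 u) us)) -(fsetU1K (contra (s2 u) us)).
by rewrite e.
Qed.

Lemma sum_configs (R : comNzRingType) (w : cell -> R) P s K : linext s ->
  (\sum_(X <- configs P s K) (\prod_(z <- X.2) w z) * \prod_(z <- X.1) (1 - w z)
   = mobius w P s K)%R.
Proof.
elim: s K => [|u s IH] K /=.
  by case: eqVneq => _ _; rewrite ?big_nil // big_seq1 !big_nil mulr1.
case=> us _ ls; rewrite big_cat big_map big_flatten big_map /=; congr (_ + _)%R.
  case: hasP => [[v vP /andP[av uv]]|no].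
    (* The factor 1 - (1 - w u) = w u is the weight of the peak put at u. *)
    rewrite (sum_addable _ vP av uv) -IH // mulrBl mul1r subKr mulr_sumr.
    rewrite big_seq_cond [RHS]big_seq_cond; apply: eq_bigr => X.
    rewrite andbT => /configs_sub[_ sub]; rewrite big_fsetU1 ?mulrA //=.
    by apply: contra us; exact: sub.
  rewrite sum_no_addable ?subr0 ?IH // => v vP av; apply/negP => uv.
  by apply: no; exists v => //; rewrite av.
rewrite big_filter; apply: eq_bigr => v _; rewrite big_map -IH // mulr_sumr.
rewrite big_seq_cond [RHS]big_seq_cond; apply: eq_bigr => X /=.
rewrite andbT => /configs_sub[sub _]; rewrite big_fsetU1 /=; first by rewrite mulrCA.
by apply: contra us; exact: sub.
Qed.

(** The induction on s needs partial information only: the state after treating the cells outside s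
    is the ideal of those v in [P] whose final position lies in s. *)
Lemma tableau_configs P f s : ideal P -> increasing P f -> linext s ->
  ([fset z in s | z \in shifted P f], [fset z in s | `[< is_peak P f z >]])
    \in configs P s [fset v in P | shift v (f v) \in s].
Proof.
move=> iP incf; elim: s => [|u s IH] lus.
  rewrite /= ifT; last by apply/eqP/fsetP => v; rewrite !inE andbF.
  by rewrite inE; apply/eqP; congr pair; apply/fsetP => v; rewrite !inE.
have [us lo ls] := lus; have {}IH := IH ls.
have top v : v \in s -> cell_le u v = false.
  by move=> vs; apply/negP => /(linext_max lus); rewrite vs.
have down := linext_down ls.
set K := [fset v in P | shift v (f v) \in s] in IH.
have inK v : (v \in K) = (v \in P) && (shift v (f v) \in s) by rewrite !inE.
have iK : ideal K.
  apply/idealP => x y; rewrite !inK => /andP[yP ys] xy.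
  have fxy := incf x y yP xy.
  apply/andP; split; first by move/idealP: iP; apply; eassumption.
  by apply: down ys _; rewrite /shift; cells.
rewrite /= mem_cat; case: (boolP (u \in shifted P f)) => [/shiftedP[v vP uE]|uD].
  set K' := [fset v in P | _].
  have vK : v \notin K by rewrite inK -uE (negPf us) andbF.
  have K'E : K' = v |` K.
    apply/fsetP => z; rewrite !inE; case zP: (z \in P) => /=; last first.
      by rewrite orbF; apply/esym/negP => /eqP zv; rewrite zv vP in zP.
    congr orb; apply/eqP/eqP => [|->//]; rewrite uE.
    exact: shift_inj incf zP vP.
  have iK' : ideal K'.
    apply/idealP => x y; rewrite K'E !in_fset1U => /predU1P[->|yK] xy; last first.
      by rewrite (idealP _ iK x y yK xy) orbT.
    case: eqVneq => //= ne; rewrite inK.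
    have xP : x \in P by move/idealP: iP; apply; eassumption.
    have fxy := incf x v vP xy.
    by rewrite xP lo ?uE //; move: ne xy fxy; rewrite /shift; cells.
  apply/orP; right; apply/flatten_mapP; exists v.
    rewrite mem_filter /removable K'E fsetU1K // iK in_fset1U eqxx uE.
    by rewrite andbT; rewrite /shift; cells.
  apply/mapP; eexists; first by rewrite K'E fsetU1K //; exact: IH.
  congr pair => /=; apply/fsetP => z; rewrite !inE.
    by case: eqVneq => //= ->; apply/shiftedP; exists v.
  case: eqVneq => //= ->; rewrite (negPf us) /=; apply/asboolP.
  move=> [x [k [xP ux kf lek]]]; rewrite uE in ux.
  case: (shift_eq_cases ux) => [[e1 e2]|[le lt]|[le lt]].
  - by subst x; lia.
  - have h1 : (f v <= k)%N by apply: lek; cells.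
    by lia.
  - have h1 : (f x <= f v)%N by apply: incf => //; cells.
    by lia.
have KE : [fset v in P | shift v (f v) \in u :: s] = K.
  apply/fsetP => v; rewrite !inE; case vP: (v \in P) => //=.
  case: eqVneq => //= e; case/negP: uD; apply/shiftedP; by exists v.
apply/orP; left; rewrite KE; apply/mapP; eexists; first exact: IH.
congr pair => /=.
  apply/fsetP => z; rewrite !inE; case: eqVneq => //= ->.
  by rewrite (negPf uD) (negPf us).
(* For v on the diagonal of u, addability to K says that the cells before v ended in s, hence not
   beyond u, while v did not. As u is unoccupied, v has moved past u, and this is a peak at u. *)
have -> : has (fun v => addable K v && same_content u v) P = `[< is_peak P f u >].
  apply/hasP/asboolP => [[v vP /andP[av uv]]|[v [k [vP uE kf lek]]]].
    have vK : v \notin K by case/andP: av.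
    case: (boolP (cell_le v u)) => [vu|nvu]; last first.
      exfalso.
      have nK : (v.1.-1, v.2) \in K by apply: (addable_below av); cells.
      have ns : shift (v.1.-1, v.2) (f (v.1.-1, v.2)) \in s.
        by move: nK; rewrite inK => /andP[].
      by have := top _ ns; rewrite /shift; cells.
    have uE := same_content_shift uv vu; exists v, (u.1 - v.1)%N; split=> //.
      rewrite ltnNge; apply: contra vK => le; rewrite inK vP /= lo //.
        by rewrite uE /shift; cells.
      by apply: contra uD => /eqP e; apply/shiftedP; exists v.
    move=> z zv ne; have [n [zn nv nev near]] := below_neighbor zv ne.
    have nK := addable_below av nv nev.
    have ns : shift n (f n) \in s by move: nK; rewrite inK => /andP[].
    have nP : n \in P by move: nK; rewrite inK => /andP[].
    apply: leq_trans (incf _ _ nP zn) _; rewrite leqNgt; apply/negP => lt.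
    by have := top _ ns; move: near lt; rewrite {1}uE /shift; cells.
  exists v => //; apply/andP; split; last by rewrite uE /shift; cells.
  have nK : v \notin K.
    by rewrite inK vP /=; apply: (linext_max lus); rewrite uE /shift; cells.
  apply: addableP => // z zv ne.
  have zP : z \in P by move/idealP: iP; apply; eassumption.
  have fz := lek z zv ne; rewrite inK zP lo // uE /shift; first by cells.
  by cells.
apply/fsetP => z; case: asboolP => pu; rewrite !inE; case: eqVneq => //= ->.
  by apply/asboolP.
by rewrite (asboolF pu) (negPf us).
Qed.

(** When v is placed at u, its shift is the diagonal distance u.1 - v.1. The result stays increasing
    because the neighbours of v end inside s, where no cell lies beyond u. *)
Lemma configs_tableau P s K X : linext s -> ideal K ->
  X \in configs P s K -> exists f, [/\ increasing K f, X.1 = shifted K f &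
    forall v, v \in K -> shift v (f v) \in s].
Proof.
elim: s K X => [|u s IH] K X /=.
  case: eqVneq => // -> _ _; rewrite inE => /eqP ->; exists (fun=> 0%N).
  split=> [z v|/=|v]; rewrite ?inE //; apply/fsetP => z; rewrite inE.
  by apply/esym/shiftedP => -[v]; rewrite inE.
move=> lus iK; have [us lo ls] := lus.
have top v : v \in s -> cell_le u v = false.
  by move=> vs; apply/negP => /(linext_max lus); rewrite vs.
rewrite mem_cat => /orP[/mapP[Y /(IH _ _ ls iK)[g [ig gD gs]] ->]|].
  by exists g; split=> // v vK; rewrite inE gs ?orbT.
case/flatten_mapP => v; rewrite mem_filter => /andP[/andP[rv uv] vK].
have [_ iKv] := andP rv.
case/mapP => Y /(IH _ _ ls iKv)[g [ig gD gs]] ->.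
have av := addable_fsetD1 iK rv.
have vu : cell_le v u.
  apply: contraT => nvu.
  have nK : (v.1.-1, v.2) \in (K `\ v) by apply: (addable_below av); cells.
  have ns := gs _ nK.
  by have := top _ ns; rewrite /shift; cells.
have uE := same_content_shift uv vu; set k := (u.1 - v.1)%N in uE.
exists (fun z => if z == v then k else g z); split.
- move=> x y yK xy; case: (eqVneq y v) => [yv|yv]; last first.
    have yKv : y \in K `\ v by rewrite !inE yv.
    rewrite ifN; first exact: ig.
    apply: contra yv => /eqP xv; apply/eqP; apply: (removable_max rv) => //.
    by rewrite -xv.
  subst y; case: eqVneq => // ne.
  have [n [xn nv nev near]] := below_neighbor xy ne.
  have nK := addable_below av nv nev; have ns := gs _ nK.
  apply: leq_trans (ig _ _ nK xn) _; rewrite leqNgt; apply/negP => lt.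
  by have := top _ ns; move: near lt; rewrite {1}uE /shift; cells.
- rewrite /= gD; apply/fsetP => z; rewrite in_fset1U; apply/predU1P/shiftedP.
    case=> [->|/shiftedP[x xK ->]]; first by exists v; rewrite ?eqxx.
    by move: xK; rewrite !inE => /andP[xv xK]; exists x; rewrite ?(negPf xv).
  case=> x xK ->; case: eqVneq => [->|ne]; first by left.
  by right; apply/shiftedP; exists x; rewrite // !inE ne.
- move=> x xK; case: eqVneq => [->|ne]; first by rewrite inE -uE eqxx.
  by rewrite inE gs ?orbT // !inE ne.
Qed.

End Tableaux.

(** * Excited moves as unit steps of the shift function *)

Section ExcitedTableaux.
Local Open Scope fset_scope.
Implicit Types (K P D L : {fset cell}) (u v x y z : cell) (f g : cell -> nat).

(** One excited move of the cell v. Monotonicity of g forces f to be strictly larger at the cells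
    beyond v, which is what frees the three positions next to the current one of v. *)
Definition bump P f g v := [/\ ideal P, increasing P f, increasing P g, v \in P &
  forall z, g z = (f z + (z == v))%N].

Lemma bump_at P f g v : bump P f g v -> g v = (f v).+1.
Proof. by case=> _ _ _ _ ->; rewrite eqxx addn1. Qed.

Lemma bump_other P f g v z : bump P f g v -> z != v -> g z = f z.
Proof. by case=> _ _ _ _ -> /negPf ->; rewrite addn0. Qed.

Lemma bump_above P f g v z : bump P f g v -> z \in P -> cell_le v z -> z != v ->
  (f v < f z)%N.
Proof.
move=> bu zP vz ne; rewrite -(bump_at bu) -(bump_other bu ne).
by case: bu => _ _ + _ _; apply.
Qed.

Lemma shifted_bump P f g v : bump P f g v ->
  shifted P g = excited_move (shift v (f v)) (shifted P f).
Proof.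
move=> bu; have [iP incf incg vP gE] := bu; set p := shift v (f v).
apply/fsetP => z; rewrite /excited_move in_fset1U in_fsetD1.
apply/shiftedP/orP => [[x xP ->]|].
  have [->|ne] := eqVneq x v.
    by left; rewrite (bump_at bu) /cellSE /shift /= !addnS.
  right; rewrite (bump_other bu ne); apply/andP; split.
    by apply: contra ne => /eqP /(shift_inj incf xP vP) ->.
  by apply/shiftedP; exists x.
case=> [/eqP ->|/andP[zp /shiftedP[x xP zE]]].
  by exists v; rewrite // (bump_at bu) /cellSE /shift /= !addnS.
exists x; rewrite // (bump_other bu) //; apply: contra zp => /eqP xv.
by rewrite zE xv.
Qed.

Lemma active_bump P f g v la : bump P f g v -> is_part la ->
  cellSE (shift v (f v)) \in diagram la -> active la (shifted P f) (shift v (f v)).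
Proof.
move=> bu pla; have [iP incf incg vP gE] := bu.
set p := shift v (f v) => se; have pE : p = shift v (f v) by [].
 have /idealP ila := ideal_diagram pla.
have pD : p \in shifted P f by apply/shiftedP; exists v.
clearbody p; have p1 : p.1 = (v.1 + f v)%N by rewrite pE.
have p2 : p.2 = (v.2 + f v)%N by rewrite pE.
have out a b : (a <= 1)%N -> (b <= 1)%N -> (0 < a + b)%N ->
    (p.1 + a, p.2 + b)%N \notin shifted P f.
  move=> a1 b1 ab; apply/shiftedP => -[x xP] [].
  case: (boolP (cell_le v x)) => [vx|nvx].
    have [->|xv] := eqVneq x v; first by lia.
    by have := bump_above bu xP vx xv; move: vx; cells.
  case: (boolP (cell_le x v)) => [xv|nxv]; last by move: nvx nxv; cells.
  by have := incf _ _ vP xv; move: nvx xv; cells.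
have inD a b : (a <= 1)%N -> (b <= 1)%N -> (0 < a + b)%N ->
    (p.1 + a, p.2 + b)%N \in diagram la `\` shifted P f.
  move=> a1 b1 ab; rewrite in_fsetD out //=; apply: ila se _.
  by rewrite /cell_le /cellSE /=; lia.
have eS : cellS p = (p.1 + 1, p.2 + 0)%N by rewrite /cellS addn1 addn0.
have eE : cellE p = (p.1 + 0, p.2 + 1)%N by rewrite /cellE addn1 addn0.
have eSE : cellSE p = (p.1 + 1, p.2 + 1)%N by rewrite /cellSE !addn1.
by rewrite /active pD eS eE eSE !inD.
Qed.

(** A peak left by z at shift k is lost only if v precedes z and f v = k. A cell strictly between v
    and z would have a shift above f v, contradicting the peak; so z is the right or lower neighbour
    of v, and the lost peak is the right or lower neighbour of the position left by v. Since the
    cells before v have not moved, that position becomes a peak. *)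
Lemma is_peak_bump P f g v : bump P f g v -> (forall z, cell_le z v -> z != v -> f z = 0%N) ->
  forall x, is_peak P g x <-> x = shift v (f v) \/
    [/\ is_peak P f x, x != cellE (shift v (f v)) & x != cellS (shift v (f v))].
Proof.
move=> bu low x; have [iP incf incg vP gE] := bu; split.
  move=> [z [k [zP xE kg lek]]]; have [zv|zv] := eqVneq z v.
    subst z; rewrite (bump_at bu) in kg; have [ke|kne] := eqVneq k (f v).
      by left; rewrite xE ke.
    right; split; try by rewrite xE /shift; cells.
    exists v, k; split=> //; first by lia.
    by move=> u uv ne; rewrite -(bump_other bu ne) lek.
  right; rewrite (bump_other bu zv) in kg.
  have above : cell_le v z -> (f v < k)%N.
    by move=> vz; rewrite -(bump_at bu) lek // eq_sym.
  have below : cell_le z v = false.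
    by apply/negP => zlv; rewrite (low z zlv zv) in kg.
  have fvz : cell_le v z -> (f v < f z)%N by move=> vz; apply: bump_above bu _ _ _.
  split.
  - exists z, k; split=> // u uz ne; apply: leq_trans (lek u uz ne).
    by rewrite gE leq_addr.
  - apply/negP; rewrite xE => e; case: (boolP (cell_le v z)) => [vz|nvz].
      by have := above vz; move: e vz; rewrite /shift; cells.
    by move: e nvz below; rewrite /shift; cells.
  - apply/negP; rewrite xE => e; case: (boolP (cell_le v z)) => [vz|nvz].
      by have := above vz; move: e vz; rewrite /shift; cells.
    by move: e nvz below; rewrite /shift; cells.
case=> [->|[[z [k [zP xE kf lek]]] nE nS]].
  exists v, (f v); split=> //; first by rewrite (bump_at bu).
  by move=> u uv ne; rewrite (bump_other bu) // low.
exists z, k; split=> //; first by rewrite gE; lia.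
move=> u uz ne; have [uv|uv] := eqVneq u v; last by rewrite (bump_other bu) // lek.
subst u; rewrite (bump_at bu); have := lek v uz ne; rewrite leq_eqVlt => /predU1P[kE|//].
have step n : cell_le v n -> n != v -> cell_le n z -> n != z -> (f v < k)%N.
  move=> vn nv nz nez; have nP : n \in P by move/idealP: iP; apply; eassumption.
  by apply: leq_trans (bump_above bu nP vn nv) (lek n nz nez).
case/orP: (above_neighbor uz ne) => nz.
  apply: (step (cellE v)) nz _; [by cells | by cells |].
  by apply: contra nE => /eqP e; rewrite xE -e -kE /shift; cells.
apply: (step (cellS v)) nz _; [by cells | by cells |].
by apply: contra nS => /eqP e; rewrite xE -e -kE /shift; cells.
Qed.


Lemma in_fset_sep P (p : pred cell) z : (z \in [fset x in P | p x]) = (z \in P) && p z.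
Proof. by rewrite !inE. Qed.

Lemma uniq_map_inj (T U : eqType) (h : T -> U) (l : seq T) :
  uniq (map h l) -> {in l &, injective h}.
Proof.
elim: l => //= a l IH /andP[al ul] x y; rewrite !inE.
case/predU1P=> [->|xl] /predU1P[->|yl] // e; last exact: IH.
  by case/negP: al; rewrite e; apply: map_f.
by case/negP: al; rewrite -e; apply: map_f.
Qed.

Section Skew.
Variables (la mu : seq nat).
Hypotheses (la_part : is_part la) (mu_part : is_part mu).
Hypothesis mu_la : diagram mu `<=` diagram la.

Lemma shift0 v : shift v 0 = v.
Proof. by rewrite /shift !addn0 -surjective_pairing. Qed.

Lemma shifted0 P f : (forall v, v \in P -> f v = 0%N) -> shifted P f = P.
Proof.
move=> f0; apply/fsetP => z; apply/shiftedP/idP => [[x xP ->]|zP].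
  by rewrite f0 // shift0.
by exists z; rewrite // f0 // shift0.
Qed.

(** The free positions next to an active cell show that the right and lower neighbours of v within
    mu have moved further than v, so raising the shift of v by 1 keeps it increasing. *)
Lemma excited_shifted D : excited la mu D -> exists f,
  [/\ increasing (diagram mu) f, D = shifted (diagram mu) f &
      forall v, v \in diagram mu -> shift v (f v) \in diagram la].
Proof.
have imu := ideal_diagram mu_part.
elim=> [|{}D u _ [f [incf -> fla]] au].
  exists (fun=> 0%N); split=> // [|v vmu]; first by rewrite shifted0.
  by rewrite shift0; exact: fsubsetP mu_la v vmu.
have [uD cS cE cSE] := and4P au; have [v vmu uE] := shiftedP _ _ _ uD.
have bound n : cell_le v n -> n \in diagram mu ->
    shift n (f v) \notin shifted (diagram mu) f -> (f v < f n)%N.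
  move=> vn nmu nD; rewrite ltn_neqAle incf // andbT; apply: contra nD => /eqP e.
  by apply/shiftedP; exists n; rewrite // e.
have incg : increasing (diagram mu) (fun z => f z + (z == v))%N.
  move=> x y ymu xy; have fxy := incf x y ymu xy.
  have [xv|xv] := eqVneq x v; last by rewrite addn0 (leq_trans fxy) ?leq_addr.
  have [yv|yv] := eqVneq y v; first by rewrite xv yv.
  subst x; rewrite addn0 addn1; rewrite eq_sym in yv.
  case/orP: (above_neighbor xy yv) => ny; apply: leq_trans (incf _ _ ymu ny).
    apply: bound; [by cells | by move/idealP: imu; apply; eassumption|].
    by move: cE; rewrite in_fsetD uE => /andP[].
  apply: bound; [by cells | by move/idealP: imu; apply; eassumption|].
  by move: cS; rewrite in_fsetD uE => /andP[].
have bu : bump (diagram mu) f (fun z => f z + (z == v))%N v by split.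
exists (fun z => f z + (z == v))%N; split=> //.
  by rewrite (shifted_bump bu) uE.
move=> x xmu; have [->|ne] := eqVneq x v; last by rewrite addn0 fla.
by move: cSE; rewrite in_fsetD uE /cellSE /shift /= addn1 !addnS => /andP[].
Qed.

(** Peaks do not depend on the order of the moves, so a convenient one suffices: the last move is
    that of a cell with nonzero shift and all cells before it at rest, the situation of
    [is_peak_bump]. *)
Lemma shifted_has_peaks f : increasing (diagram mu) f ->
  (forall v, v \in diagram mu -> shift v (f v) \in diagram la) ->
  has_peaks la mu (shifted (diagram mu) f)
    [fset z in diagram la | `[< is_peak (diagram mu) f z >]].
Proof.
have imu := ideal_diagram mu_part; have ila := ideal_diagram la_part.
set P := diagram mu in imu *.
elim: {f}_.+1 {-2}f (ltnSn (\sum_(v <- P) f v)) => // n IH f.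
case: (pselect (exists2 v : cell, v \in P & (0 < f v)%N)) => [|none]; last first.
  have f0 v : v \in P -> f v = 0%N.
    by move=> vP; apply/eqP; rewrite -leqn0 leqNgt; apply/negP => fv; apply: none; exists v.
  move=> _ incf fla; rewrite shifted0 // (_ : [fset z in _ | _] = fset0).
    exact: has_peaks_start.
  apply/fsetP => z; rewrite in_fset_sep in_fset0; apply/negP => /andP[_ /asboolP[v [k [vP _]]]].
  by rewrite f0.
move=> [x xP fx] sum_n incf fla.
have [v [vP fv low]] : exists v : cell, [/\ v \in P, (0 < f v)%N &
    forall z, cell_le z v -> z != v -> f z = 0%N].
  have := @arg_minnP P [` xP]%fset (fun v : P => 0 < f (val v))%N
            (fun v : P => (val v).1 + (val v).2)%N fx.
  case=> v fv vmin; exists (val v); split=> //; first exact: fsvalP.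
  move=> z zv ne; have zP : z \in P.
    by move/idealP: imu; apply; [exact: fsvalP | exact: zv].
  apply/eqP; rewrite -leqn0 leqNgt; apply/negP => fz.
  have := vmin [` zP]%fset fz => /=; move: zv ne; clear.
  by case: v => -[a b] /= _; cells.
pose g z := (f z - (z == v))%N.
have fE z : f z = (g z + (z == v))%N.
  by rewrite /g; case: eqVneq => [->|]; lia.
have incg : increasing P g.
  move=> y z zP yz; rewrite /g; have fyz := incf y z zP yz.
  have [zv|_] := eqVneq z v; last by case: eqVneq; lia.
  subst z; have [->//|yv] := eqVneq y v.
  by rewrite (low y yz yv) sub0n.
have bu : bump P g f v by split.
have gv : (f v = (g v).+1)%N := bump_at bu.
have vla := fla v vP.
have pla : cellSE (shift v (g v)) \in diagram la.
  by move: vla; rewrite gv /shift /cellSE /= !addnS.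
have act := active_bump bu la_part pla.
have glow z : cell_le z v -> z != v -> g z = 0%N.
  by move=> zv ne; rewrite /g low.
rewrite (shifted_bump bu).
have -> : [fset z in diagram la | `[< is_peak P f z >]] =
    peak_move (shift v (g v)) [fset z in diagram la | `[< is_peak P g z >]].
  apply/fsetP => z; rewrite /peak_move in_fset1U in_fsetD in_fset2 !in_fset_sep.
  apply/idP/idP.
    case/andP=> zla /asboolP /(is_peak_bump bu glow)[->|[pk nE nS]].
      by rewrite eqxx.
    by rewrite negb_or nE nS zla asboolT ?orbT.
  case/predU1P => [->|/andP[]].
    apply/andP; split; last by apply/asboolP/(is_peak_bump bu glow); left.
    by move/idealP: ila; apply; [exact: pla | rewrite /cellSE; cells].
  rewrite negb_or => /andP[nE nS] /andP[zla /asboolP pk].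
  by rewrite zla; apply/asboolP/(is_peak_bump bu glow); right.
apply: has_peaks_step act; apply: IH => //.
  have : (\sum_(z <- P) g z < \sum_(z <- P) f z)%N; last by lia.
  rewrite (big_fsetD1 v) //= [X in (_ < X)%N](big_fsetD1 v) //= gv addSn ltnS leq_add2l.
  by apply: leq_sum => z _; rewrite /g leq_subr.
move=> z zP; move/idealP: ila; apply; first exact: fla zP.
by rewrite /shift /g; cells.
Qed.

Lemma has_peaks_excited D L : has_peaks la mu D L -> excited la mu D.
Proof.
by elim=> [|{}D {}L u _ eD au]; [exact: excited_start | exact: excited_step].
Qed.

Lemma shifted_config s f : linext s -> s =i diagram la ->
  increasing (diagram mu) f ->
  (forall v, v \in diagram mu -> shift v (f v) \in diagram la) ->
  (shifted (diagram mu) f, [fset z in diagram la | `[< is_peak (diagram mu) f z >]])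
    \in configs (diagram mu) s (diagram mu).
Proof.
move=> ls sE incf fla.
have := tableau_configs (ideal_diagram mu_part) incf ls.
have -> : [fset v in diagram mu | shift v (f v) \in s] = diagram mu.
  apply/fsetP => v; rewrite in_fset_sep; apply/andP/idP => [[]//|vmu].
  by split=> //; rewrite sE fla.
have -> : [fset z in s | z \in shifted (diagram mu) f] = shifted (diagram mu) f.
  apply/fsetP => z; rewrite in_fset /= inE sE; apply/andP/idP => [[]//|zD]; split=> //.
  by case/shiftedP: zD => v vmu ->; exact: fla.
suff -> : [fset z in s | `[< is_peak (diagram mu) f z >]] =
  [fset z in diagram la | `[< is_peak (diagram mu) f z >]] by [].
by apply/fsetP => z; rewrite in_fset_sep in_fset /= inE sE.
Qed.

Lemma configs_peaks s X : linext s -> s =i diagram la ->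
  X \in configs (diagram mu) s (diagram mu) ->
  excited la mu X.1 /\ peaks la mu X.1 = X.2.
Proof.
move=> ls sE XC; have [f [incf XD fs]] := configs_tableau ls (ideal_diagram mu_part) XC.
have fla v : v \in diagram mu -> shift v (f v) \in diagram la.
  by move=> vmu; rewrite -sE fs.
have := shifted_has_peaks incf fla; have := shifted_config ls sE incf fla.
set L := [fset z in _ | _] => YC hp; have eX := has_peaks_excited hp.
rewrite XD; split=> //; rewrite (has_peaks_uniq (has_peaksP eX) hp).
(* [X] and the configuration built from [f] have the same set of cells, hence are equal. *)
by have -> := uniq_map_inj (configs_uniq _ _ ls) XC YC XD.
Qed.

Lemma configs_excited s : linext s -> s =i diagram la ->
  perm_eq [seq X.1 | X <- configs (diagram mu) s (diagram mu)]
          (excited_diagrams la mu).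
Proof.
move=> ls sE; apply: uniq_perm; rewrite ?configs_uniq ?fset_uniq // => D.
apply/mapP/idP => [[X XC ->]|].
  by apply/(in_excited_diagrams _ mu_la); case: (configs_peaks ls sE XC).
move/(in_excited_diagrams _ mu_la)/excited_shifted => [f [incf -> fla]].
by eexists; first exact: shifted_config ls sE incf fla.
Qed.

End Skew.
End ExcitedTableaux.

(** * Reverse plane partitions *)

Section ZeroSets.
Variables (lam : {fset cell}) (B : nat).
Local Notation T := (fset_sub_type lam).
Implicit Types (g : {ffun T -> 'I_B.+1}) (K L : {fset cell}).

Definition monotone g :=
  [forall u : T, forall v : T, cell_le (val u) (val v) ==> (g u <= g v)%N].

Definition vanishes K g := [forall u : T, (val u \in K) ==> (g u == 0%N :> nat)].

Definition entry_sum g := (\sum_(u : T) g u)%N.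
Definition diag_sum g := (\sum_(u : T | (val u).1 == (val u).2) g u)%N.

Definition zeros g : {fset cell} := [fset val u | u in T & g u == 0%N :> nat]%fset.

Definition outside K := (\sum_(u : T) (val u \notin K))%N.
Definition diag_outside K := (\sum_(u : T | (val u).1 == (val u).2) (val u \notin K))%N.

(** The coefficient of q ^ n, as a series in t. A reverse plane partition of shape lam/K is a
    monotone filling of lam that vanishes on K, so that all K share one type; the bound [B] makes
    that type finite and excludes nothing when n <= [B]. *)
Definition rpp_coef K n : fps int :=
  \sum_(g | [&& monotone g, vanishes K g & entry_sum g == n]) fpsX ^+ diag_sum g.

Lemma monotoneP g :
  reflect (forall u v : T, cell_le (val u) (val v) -> (g u <= g v)%N) (monotone g).
Proof.
apply: (iffP forallP) => [h u v|h u]; first by move/forallP: (h u) => /(_ v)/implyP.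
by apply/forallP => v; apply/implyP/h.
Qed.

Lemma vanishesP K g :
  reflect (forall u : T, val u \in K -> g u = 0%N :> nat) (vanishes K g).
Proof.
apply: (iffP forallP) => [h u uK|h u]; first by apply/eqP/(implyP (h u)).
by apply/implyP => /h ->.
Qed.

Lemma zerosE g (u : T) : (val u \in zeros g) = (g u == 0%N :> nat).
Proof.
apply/imfsetP/idP => [[v /=]|gu]; last by exists u; rewrite //= inE.
by rewrite !inE => gv /val_inj ->.
Qed.

Lemma zeros_sub g : (zeros g `<=` lam)%fset.
Proof. by apply/fsubsetP => z /imfsetP[u _ ->]; exact: fsvalP. Qed.

Lemma eq_fset_sub K L : (K `<=` lam)%fset -> (L `<=` lam)%fset ->
  (forall u : T, (val u \in K) = (val u \in L)) -> K = L.
Proof.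
move=> Ks Ls h; apply/fsetP => z; apply/idP/idP => zK.
  by have := h [` fsubsetP Ks z zK]%fset; rewrite /= zK.
by have := h [` fsubsetP Ls z zK]%fset; rewrite /= zK.
Qed.

Lemma zeros_ideal g : ideal lam -> monotone g -> ideal (zeros g).
Proof.
move=> /idealP il /monotoneP mg; apply/idealP => x y yz xy.
have yl := fsubsetP (zeros_sub g) y yz; have xl := il x y yl xy.
have := zerosE g [` xl]%fset; have := zerosE g [` yl]%fset => /=; rewrite yz.
move=> gy ->; have := mg [` xl]%fset [` yl]%fset xy.
by rewrite (eqP (esym gy)) leqn0.
Qed.

Lemma vanishes_zeros K g : (K `<=` lam)%fset ->
  vanishes K g = (K `<=` zeros g)%fset.
Proof.
move=> Kl; apply/vanishesP/fsubsetP => [h z zK|h u uK].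
  by have /= -> := zerosE g [` fsubsetP Kl z zK]%fset; apply/eqP/h.
by apply/eqP; rewrite -zerosE; exact: h.
Qed.

(** [inord] sends a value above [B] to 0, so adding 1 is faithful only under a bound such as that of
    [raise_outsideE]. *)
Definition raise_outside L g : {ffun T -> 'I_B.+1} :=
  [ffun u => inord (g u + (val u \notin L))].
Definition lower_outside L g : {ffun T -> 'I_B.+1} :=
  [ffun u => inord (g u - (val u \notin L))].

Lemma lower_outsideE L g u : lower_outside L g u = (g u - (val u \notin L))%N :> nat.
Proof. by rewrite ffunE inordK //; apply: leq_ltn_trans (leq_subr _ _) (ltn_ord _). Qed.

Lemma le_entry_sum g u : (g u <= entry_sum g)%N.
Proof. by rewrite /entry_sum (bigD1 u) //= leq_addr. Qed.

Lemma outside_gt0 L (u : T) : val u \notin L -> (0 < outside L)%N.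
Proof. by move=> uL; rewrite /outside (bigD1 u) //= uL. Qed.

Lemma raise_outsideE L g u : (entry_sum g + outside L <= B)%N ->
  raise_outside L g u = (g u + (val u \notin L))%N :> nat.
Proof.
move=> le; rewrite ffunE inordK // ltnS; apply: leq_trans le.
apply: leq_add; first exact: le_entry_sum.
by case uL: (val u \notin L) => //; apply: outside_gt0 uL.
Qed.

Lemma entry_sum_split L g (h : {ffun T -> 'I_B.+1}) :
  (forall u, g u = (h u + (val u \notin L))%N :> nat) ->
  (entry_sum g = entry_sum h + outside L)%N /\ (diag_sum g = diag_sum h + diag_outside L)%N.
Proof.
by move=> e; split; rewrite -big_split; apply: eq_bigr => u _; exact: e.
Qed.

(** Adding 1 off L matches fillings vanishing on L with fillings whose zero set is exactly L. In the
    forward direction the condition on [lower_outside], together with the zero set, rules out values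
    truncated by [inord]. *)
Lemma raise_outside_zeros L g n : ideal lam -> ideal L -> (L `<=` lam)%fset ->
  (n <= B)%N -> (outside L <= n)%N ->
  [&& monotone (raise_outside L g), entry_sum (raise_outside L g) == n, zeros (raise_outside L g) == L &
      lower_outside L (raise_outside L g) == g] =
  [&& monotone g, vanishes L g & entry_sum g == (n - outside L)%N].
Proof.
move=> il /idealP iL Ls nB Ln; apply/and4P/and3P.
  move=> [/monotoneP m /eqP tn /eqP zL /eqP gl].
  have gE u : g u = (raise_outside L g u - (val u \notin L))%N :> nat by rewrite -[in LHS]gl lower_outsideE.
  have zE u : (val u \in L) = (raise_outside L g u == 0%N :> nat) by rewrite -{1}zL zerosE.
  have hE u : raise_outside L g u = (g u + (val u \notin L))%N :> nat.
    by rewrite gE subnK // zE; case: (nat_of_ord (raise_outside L g u)).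
  split.
  - apply/monotoneP => u v uv; rewrite gE; case uL: (val u \in L) => /=.
      by move: uL; rewrite zE => /eqP ->.
    have vL : val v \notin L by apply/negP => vL; rewrite (iL _ _ vL uv) in uL.
    by rewrite gE vL leq_sub2r // m.
  - by apply/vanishesP => u uL; rewrite gE uL; apply/eqP; rewrite subn0 -zE.
  - by apply/eqP; have [] := entry_sum_split hE; rewrite tn => ->; rewrite addnK.
move=> [/monotoneP m /vanishesP z /eqP t].
have hE u : raise_outside L g u = (g u + (val u \notin L))%N :> nat.
  by apply: raise_outsideE; rewrite t subnK.
split.
- apply/monotoneP => u v uv; rewrite !hE leq_add ?m //.
  case vL: (val v \in L); first by rewrite (iL _ _ vL uv).
  by case: (val u \in L).
- by apply/eqP; have [-> _] := entry_sum_split hE; rewrite t subnK.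
- apply/eqP/eq_fset_sub => // [|u]; first exact: zeros_sub.
  rewrite zerosE hE; case uL: (val u \in L); last by rewrite addn1.
  by rewrite z.
- by apply/eqP/ffunP => u; apply/val_inj; rewrite /= lower_outsideE hE addnK.
Qed.

Lemma rpp_coef_rec K n : ideal lam -> (K `<=` lam)%fset -> (n <= B)%N ->
  rpp_coef K n = \sum_(L <- fpowerset lam | ideal L && (K `<=` L)%fset)
    if (outside L <= n)%N then fpsX ^+ diag_outside L * rpp_coef L (n - outside L)%N
    else 0.
Proof.
move=> il Kl nB.
transitivity (\sum_(g | [&& monotone g, vanishes K g & entry_sum g == n])
    \sum_(L <- fpowerset lam | L == zeros g) fpsX ^+ diag_sum g : fps int).
  apply: eq_bigr => g _; rewrite big_mkcond (big_fsetD1 (zeros g)) /=; last first.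
    by rewrite fpowersetE zeros_sub.
  rewrite eqxx big1_fset ?addr0 // => L.
  by rewrite !inE => /andP[/negPf -> _].
rewrite (exchange_big_dep xpredT) //= [RHS]big_mkcond.
rewrite big_seq_cond [RHS]big_seq_cond; apply: eq_bigr => L.
rewrite andbT fpowersetE => Ls; case: ifP => [/andP[iL KL]|nL]; last first.
  apply: big1 => g /andP[/and3P[mg vg _] /eqP LE]; move: nL.
  by rewrite LE zeros_ideal // -vanishes_zeros // vg.
case: (leqP (outside L) n) => [Ln|nL]; last first.
  apply: big1 => g /andP[/and3P[_ _ /eqP tg] /eqP LE]; move: nL; rewrite -tg ltnNge.
  case/negP; apply: leq_sum => u _; rewrite LE zerosE.
  by case: (nat_of_ord (g u)).
rewrite (reindex_onto (raise_outside L) (lower_outside L)) /=; last first.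
  move=> g /andP[/and3P[_ _ /eqP tg] /eqP LE]; apply/ffunP => u; apply/val_inj => /=.
  have lE v : g v = (lower_outside L g v + (val v \notin L))%N :> nat.
    by rewrite lower_outsideE subnK // LE zerosE; case: (nat_of_ord (g v)).
  by rewrite raise_outsideE -?lE //; have [<- _] := entry_sum_split lE; rewrite tg.
rewrite mulr_sumr /rpp_coef; apply: eq_big => [g|g].
  rewrite -(raise_outside_zeros g il iL Ls nB Ln).
  rewrite vanishes_zeros // [L == _]eq_sym.
  case zL: (zeros (raise_outside L g) == L); last by rewrite !andbF.
  by rewrite (eqP zL) KL; case: (monotone _) => //; case: (_ == n).
case/andP=> /andP[/and3P[mg vg tg] zg] lg.
have : [&& monotone (raise_outside L g), entry_sum (raise_outside L g) == n, zeros (raise_outside L g) == L &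
      lower_outside L (raise_outside L g) == g] by rewrite mg tg eq_sym zg lg.
rewrite raise_outside_zeros // => /and3P[_ _ /eqP t].
have hE u : raise_outside L g u = (g u + (val u \notin L))%N :> nat.
  by apply: raise_outsideE; rewrite t subnK.
by have [_ ->] := entry_sum_split hE; rewrite exprD mulrC.
Qed.

End ZeroSets.

Lemma fcoef_sum (R : comNzRingType) (I : Type) (r : seq I) (p : pred I)
    (F : I -> fps R) n :
  fcoef (\sum_(i <- r | p i) F i) n = \sum_(i <- r | p i) fcoef (F i) n.
Proof. by apply: (big_morph (fun f => fcoef f n)) => // f g; rewrite fcoefD. Qed.

Lemma t_exp k : t ^+ k = fpsC (fpsX ^+ k).
Proof. by elim: k => [//|k IH]; rewrite !exprS IH /t -fpsCM. Qed.

Lemma fcoef_qtM m k (f : fps_qt) n :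
  fcoef (q ^+ m * t ^+ k * f) n =
  if (m <= n)%N then fpsX ^+ k * fcoef f (n - m) else 0.
Proof. by rewrite -mulrA fcoefXnM t_exp fcoefCM. Qed.

Lemma outside_full lam : outside lam lam = 0%N.
Proof. by rewrite /outside big1 // => u _; rewrite fsvalP. Qed.

Lemma outside_lt lam K L : (K `<=` L)%fset -> (L `<=` lam)%fset -> L != K ->
  (outside lam L < outside lam K)%N.
Proof.
move=> KL Ll ne; have [x xL xK] : exists2 x, x \in L & x \notin K.
  apply/fsubsetPn; apply: contra ne => LK; by rewrite eqEfsubset LK.
have xl := fsubsetP Ll x xL.
rewrite /outside (bigD1 [` xl]%fset) //= [X in (_ < X)%N](bigD1 [` xl]%fset) //=.
rewrite xL xK add0n add1n ltnS; apply: leq_sum => u _.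
by case uK: (val u \in K); rewrite ?(fsubsetP KL _ uK) //; case: (_ \in _).
Qed.

Lemma rpp_coef_unique lam B (G : {fset cell} -> fps_qt) : ideal lam ->
  (forall K, ideal K -> (K `<=` lam)%fset ->
     G K = \sum_(L <- fpowerset lam | ideal L && (K `<=` L)%fset)
       q ^+ outside lam L * t ^+ diag_outside lam L * G L) ->
  G lam = 1 ->
  forall K n, ideal K -> (K `<=` lam)%fset -> (n <= B)%N ->
    rpp_coef lam B K n = fcoef (G K) n.
Proof.
move=> il recG G1 K n.
(* The lexicographic order on ([outside lam K], n), encoded in one number since n <= [B]: the term L
   = K lowers n, every other term lowers [outside]. *)
have [N] := ubnP (outside lam K * B.+1 + n)%N.
elim: N K n => // N IH K n lt iK Kl nB; have [KE|Kne] := eqVneq K lam.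
  rewrite KE G1 fcoef1 /rpp_coef.
  pose z : {ffun fset_sub_type lam -> 'I_B.+1} := [ffun=> ord0].
  have zP (g : {ffun fset_sub_type lam -> 'I_B.+1}) : vanishes lam g -> g = z.
    move/vanishesP => vg; apply/ffunP => u; apply/val_inj; rewrite ffunE /=.
    exact/vg/fsvalP.
  have tz : entry_sum z = 0%N by rewrite /entry_sum big1 // => u _; rewrite ffunE.
  case: eqVneq => [->|n0]; last first.
    by apply: big1 => g /and3P[_ /zP -> /eqP]; rewrite tz => e; case/eqP: n0.
  rewrite (big_pred1 z) => [|g].
    by rewrite /diag_sum big1 // => u _; rewrite ffunE.
  apply/and3P/eqP => [[_ /zP //]|->]; split; last by rewrite tz.
    by apply/monotoneP => u v _; rewrite !ffunE.
  by apply/vanishesP => u _; rewrite ffunE.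
rewrite rpp_coef_rec // recG // fcoef_sum big_seq_cond [RHS]big_seq_cond.
apply: eq_bigr => L; rewrite fpowersetE => /and3P[Ll iL KL]; rewrite fcoef_qtM.
case: leqP => // mn; congr (_ * _); apply: IH => //; last first.
  by apply: leq_trans nB; exact: leq_subr.
have oK : (0 < outside lam K)%N.
  have := outside_lt Kl (fsubset_refl lam); rewrite outside_full.
  by apply; rewrite eq_sym.
have [LK|LK] := eqVneq L K; first by rewrite -LK in oK lt *; lia.
have lt1 := outside_lt KL Ll LK.
have : (outside lam L * B.+1 + B.+1 <= outside lam K * B.+1)%N.
  by rewrite -mulSnr leq_mul2r lt1 orbT.
by lia.
Qed.

(** * Skew fillings as fillings of la that vanish on mu *)

Section SkewShapes.
Variables la mu : seq nat.
Hypotheses (la_part : is_part la) (mu_part : is_part mu).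
Local Notation T := (fset_sub_type (diagram la)).
Local Notation S := (fset_sub_type (Defs.skew la mu)).

Lemma skew_sub : (Defs.skew la mu `<=` diagram la)%fset.
Proof. exact: fsubsetDl. Qed.

Definition skew_incl : S -> T := fincl skew_sub.

Lemma val_skew_incl u : val (skew_incl u) = val u.
Proof. by []. Qed.

Lemma skew_inclP (u : T) : val u \notin diagram mu -> exists v : S, u = skew_incl v.
Proof.
move=> um; have us : val u \in Defs.skew la mu by rewrite in_fsetD um fsvalP.
by exists [` us]%fset; apply/val_inj.
Qed.

Lemma sum_skew (p : pred cell) (F : T -> nat) :
  (forall u, val u \in diagram mu -> F u = 0%N) ->
  (\sum_(u : T | p (val u)) F u = \sum_(v : S | p (val v)) F (skew_incl v))%N.
Proof.
move=> F0; rewrite (bigID (fun u : T => val u \in diagram mu)) /=.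
rewrite big1 ?add0n => [|u /andP[_ /F0] //].
rewrite (reindex_omap skew_incl (fun u : T => insub (val u))) => [|u /andP[_ um]]; last first.
  have [v ->] := skew_inclP um; rewrite val_skew_incl valK //.
apply: eq_bigl => v; rewrite val_skew_incl valK eqxx andbT.
by have := fsvalP v; rewrite in_fsetD => /andP[-> _]; rewrite andbT.
Qed.

Definition skew_filling B (g : {ffun T -> 'I_B.+1}) : filling la mu :=
  [ffun v : S => nat_of_ord (g (skew_incl v))].

Lemma skew_filling_rpp B (g : {ffun T -> 'I_B.+1}) :
  monotone g -> rpp la mu (skew_filling g).
Proof.
move=> /monotoneP mg u v; rewrite !ffunE; split=> e le; apply: mg;
  by rewrite /cell_le !val_skew_incl e le leqnn.
Qed.

Lemma rpp_skew_filling B (pi : filling la mu) : rpp la mu pi ->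
  (forall v, pi v <= B)%N ->
  exists g : {ffun T -> 'I_B.+1},
    [/\ monotone g, vanishes (diagram mu) g & pi = skew_filling g].
Proof.
move=> rp pB.
pose g : {ffun T -> 'I_B.+1} :=
  [ffun u : T => if insub (val u) is Some v then inord (pi v) else ord0].
have gS v : g (skew_incl v) = pi v :> nat.
  by rewrite ffunE val_skew_incl valK inordK // ltnS.
have gmu (u : T) : val u \in diagram mu -> g u = 0%N :> nat.
  by move=> um; rewrite ffunE insubF //= in_fsetD um.
have imu := ideal_diagram mu_part; have ila := ideal_diagram la_part.
exists g; split.
- apply/monotoneP => u v uv; case: (boolP (val u \in diagram mu)) => um.
    by rewrite gmu.
  have vm : val v \notin diagram mu.
    by apply: contra um => vm; move/idealP: imu; apply; eassumption.
  move: uv; have [u' ->] := skew_inclP um; have [v' ->] := skew_inclP vm.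
  rewrite !gS !val_skew_incl => uv.
  have [ul um'] : val u' \in diagram la /\ val u' \notin diagram mu.
    by have := fsvalP u'; rewrite in_fsetD => /andP[].
  have vl : val v' \in diagram la.
    by have := fsvalP v'; rewrite in_fsetD => /andP[].
  (* Entries are compared only along rows and columns. The corner between u' and v' links the two;
     it avoids mu because u' does, and lies in la because v' does. *)
  have wS : ((val u').1, (val v').2) \in Defs.skew la mu.
    rewrite in_fsetD; apply/andP; split.
      apply: contra um' => wm; move/idealP: imu; apply; first exact: wm.
      by move: uv; rewrite /cell_le /= leqnn => /andP[].
    move/idealP: ila; apply; first exact: vl.
    by move: uv; rewrite /cell_le /= leqnn andbT => /andP[].
  have [h1 _] := rp u' [` wS]%fset; have [_ h2] := rp [` wS]%fset v'.
  by move: uv => /andP[uv1 uv2]; apply: leq_trans (h1 _ _) (h2 _ _).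
- by apply/vanishesP.
- by apply/ffunP => v; rewrite ffunE gS.
Qed.

(** Taking the bound on the entries to be n itself loses nothing, since no entry exceeds the sum of
    all. *)
Lemma fcoef_rpp_sum n :
  fcoef (fps_sum (rpp la mu) (fun pi => q ^+ rpp_size pi * t ^+ rpp_trace pi)) n
  = rpp_coef (diagram la) n (diagram mu) n.
Proof.
rewrite /fcoef /= -/(fcoef _).
pose good (g : {ffun T -> 'I_n.+1}) :=
  [&& monotone g, vanishes (diagram mu) g & entry_sum g == n].
have szE (g : {ffun T -> 'I_n.+1}) : vanishes (diagram mu) g ->
    rpp_size (skew_filling g) = entry_sum g /\ rpp_trace (skew_filling g) = diag_sum g.
  move/vanishesP => vg; split.
    apply: eq_trans (esym (sum_skew xpredT vg)).
    by apply: eq_bigr => v _; rewrite ffunE.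
  apply: eq_trans (esym (sum_skew (fun z => z.1 == z.2) vg)).
  by apply: eq_bigr => v _; rewrite ffunE.
have wE pi : fcoef (q ^+ rpp_size pi * t ^+ rpp_trace pi : fps_qt) n =
    if rpp_size pi == n then fpsX ^+ rpp_trace pi else 0.
  rewrite -[X in fcoef X _]mulr1 fcoef_qtM; case: leqP => le; last first.
    by rewrite ifN //; lia.
  rewrite fcoef1 subn_eq0; have [->|ne] := eqVneq (rpp_size pi) n.
    by rewrite leqnn mulr1.
  by rewrite (_ : (n <= _)%N = false) ?mulr0 //; lia.
rewrite (fsbigE [seq skew_filling g | g <- enum good]).
- rewrite big_map big_enum_cond /rpp_coef /=; apply: eq_big => [g|g /andP[]].
    rewrite -[RHS]/(g \in good); case: (boolP (g \in good)) => //= /and3P[mg _ _].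
    by apply/mem_set/skew_filling_rpp.
  move=> /and3P[mg vg /eqP tg] _.
  by have [sE tE] := szE g vg; rewrite wE sE tE tg eqxx.
- rewrite map_inj_in_uniq ?enum_uniq // => g h; rewrite !mem_enum.
  move=> /and3P[_ /vanishesP vg _] /and3P[_ /vanishesP vh _] /ffunP gh.
  apply/ffunP => u; apply/val_inj => /=.
  case: (boolP (val u \in diagram mu)) => um; first by rewrite vg ?vh.
  by have [v ->] := skew_inclP um; have := gh v; rewrite !ffunE.
- move=> pi /= /mapP[g]; rewrite mem_enum => /and3P[mg _ _] ->.
  exact: skew_filling_rpp.
(* A reverse plane partition missing from the finite list has size other than n and contributes
   0. *)
move=> pi rp npi; rewrite wE; case: eqVneq => // sz; case/negP: npi.
have piB v : (pi v <= n)%N by rewrite -sz /rpp_size (bigD1 v) //= leq_addr.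
have [g [mg vg piE]] := rpp_skew_filling rp piB.
apply/mapP; exists g => //; rewrite mem_enum; apply/and3P; split=> //.
by have [<- _] := szE g vg; rewrite -piE sz.
Qed.
End SkewShapes.

(** * Extreme coefficients, regularity of q and t, and sums over a box *)

(** K is not contained in the cells listed after u, so its coefficient there vanishes and only the
    term that adds u survives; every cell thus contributes its factor 1 - w u. *)
Lemma hecke_full (R : comNzRingType) (w : cell -> R) s K : linext s -> ideal K ->
  s =i K -> hecke w s K = \prod_(u <- K) (1 - w u).
Proof.
elim: s K => [|u s IH] K.
  move=> _ _ sK; have -> : K = fset0 by apply/fsetP => z; rewrite -sK.
  by rewrite /= big_nil.
move=> lus iK sK; have [us lo ls] := lus.
have uK : u \in K by rewrite -sK inE eqxx.
have ru : removable K u.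
  apply: removableP => // z zK uz; apply/eqP; apply: contraT => ne.
  move: zK; rewrite -sK inE (negPf ne) /= => zs.
  by have := linext_max lus uz; rewrite zs.
have uu : same_content u u by cells.
have [iKu sKu] : ideal (K `\ u)%fset /\ s =i (K `\ u)%fset.
  split; first by case/andP: ru.
  move=> z; rewrite !inE -sK inE; case: eqVneq => //= ->; exact: negPf us.
have nsub : ~ {subset K <= s} by move/(_ u uK); apply/negP.
have [h0 _] := recursion_support w K ls iK nsub.
rewrite /= (sum_removable _ ru uu) h0 add0r subr0 (IH _ ls iKu sKu).
by rewrite [RHS](big_fsetD1 u).
Qed.

(** The transform at P has a single term, P being the only ideal between P and P. *)
Lemma mobius_top (R : comNzRingType) (w : cell -> R) s P : ideal P ->
  mobius w P s P = hecke w s P.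
Proof.
move=> iP; rewrite (hecke_mobius _ _ iP (fsubset_refl P)) big_mkcond.
rewrite (big_fsetD1 P) /=; last by rewrite fpowersetE fsubset_refl.
rewrite iP fsubset_refl big1_fset ?addr0 // => L.
rewrite !inE fpowersetE => /andP[ne LP] _; rewrite ifN //.
by apply: contra ne => /andP[_ PL]; rewrite eqEfsubset LP PL.
Qed.

(** Multiplication by q shifts coefficients. Regularity of q and t allows the products of labels in
    the Chevalley identity to be cancelled without inverting them. *)
Lemma lreg_q : GRing.lreg q.
Proof.
by move=> f g /fpsP fg; apply/fpsP => n; have := fg n.+1; rewrite !fcoefXM.
Qed.

Lemma lreg_t : GRing.lreg t.
Proof.
move=> f g /fpsP fg; apply/fpsP => n; have := fg n; rewrite !fcoefCM => /fpsP e.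
by apply/fpsP => m; have := e m.+1; rewrite !fcoefXM.
Qed.

Lemma box_sum N B (A : {fset cell}) (p : pred cell) (F : cell -> nat) :
  in_box N B (mem A) ->
  (\sum_(u : A | p (val u)) F (val u) =
   \sum_(i < N) \sum_(j < B)
     if ((nat_of_ord i, nat_of_ord j) \in A) && p (nat_of_ord i, nat_of_ord j)
     then F (nat_of_ord i, nat_of_ord j) else 0)%N.
Proof.
move=> bA; rewrite pair_big /= -big_mkcond /=.
pose h (u : A) : 'I_N * 'I_B :=
  (Ordinal (bA _ (fsvalP u)).1, Ordinal (bA _ (fsvalP u)).2).
rewrite (reindex_omap h (fun x : 'I_N * 'I_B => insub (nat_of_ord x.1, nat_of_ord x.2))).
  apply: eq_big => [u|u _]; rewrite /h /= -surjective_pairing //.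
  by rewrite valK eqxx andbT fsvalP.
move=> [i j] /= /andP[ij _]; rewrite insubT /=; congr Some.
by congr pair; apply/val_inj.
Qed.

(** * Hook weights *)

Section Weights.
Variable la : seq nat.
Hypothesis la_part : is_part la.
Let lam := diagram la.
Let N := size la.
Let B := nth 0%N la 0.

Definition hook_weight (u : cell) : fps_qt :=
  q ^+ hook la u * t ^+ (u \in durfee la).

Lemma diagram_box : in_box N B (mem lam).
Proof.
move=> [i j] /=; rewrite in_diagram /= => ij; split.
  by rewrite ltnNge; apply: contraL ij => /(nth_default 0%N) ->.
have /idealP il := ideal_diagram la_part.
have : (0%N, j) \in diagram la.
  by apply: il (i, j) _ _; rewrite ?in_diagram //; cells.
by rewrite in_diagram.
Qed.

(** Only the condition at the larger coordinate has content. The symmetric form separates row from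
    column, as the labels require. *)
Lemma in_durfee u : u \in lam ->
  (u \in durfee la) = ((u.1, u.1) \in lam) && ((u.2, u.2) \in lam).
Proof.
move=> ul; have /idealP il := ideal_diagram la_part; apply/idP/andP.
  move=> ud; split; apply: (fsubsetP (durfee_sub la)); move: ud;
    by rewrite /durfee !in_square /= => /andP[u1 u2]; rewrite ?u1 ?u2.
move=> [h1 h2]; have : u \in square (maxn u.1 u.2).+1.
  by rewrite in_square !ltnS leq_maxl leq_maxr.
apply: (fsubsetP (durfee_max _)); apply/fsubsetP => z.
rewrite in_square !ltnS => /andP[z1 z2].
case: (leqP u.1 u.2) => le; [apply: il h2 _ | apply: il h1 _];
  move: z1 z2 le; rewrite /cell_le /=; lia.
Qed.

Lemma row_len_diagram i : row_len B (mem lam) i = nth 0%N la i.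
Proof.
have E k : (k < row_len B (mem lam) i)%N = (k < nth 0%N la i)%N.
  rewrite (row_lenE _ _ (ideal_down (ideal_diagram la_part)) diagram_box) /=.
  by rewrite in_diagram.
by have := E (row_len B (mem lam) i); have := E (nth 0%N la i); lia.
Qed.

Lemma col_len_diagram j : col_len N (mem lam) j = conj_part la j.
Proof.
rewrite /conj_part -sum1_count big_mkcond (big_nth 0%N) big_mkord /col_len.
by apply: eq_bigr => i _; rewrite /= in_diagram /=; case: ifP.
Qed.

(* The boundary step at content k - N, for which hook weights are the ratios of
   the labels of rows and columns. *)
Definition label (k : nat) : fps_qt := q ^+ k * t ^+ (N < k)%N.

(** The hook length is the distance along the boundary from the step of the column to the step of
    the row. *)
Lemma hook_weight_label u : u \in lam ->
  hook_weight u * label (N + u.2.+1 - col_len N (mem lam) u.2)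
  = label (row_pos N B (mem lam) u.1).
Proof.
move=> ul; have dl := ideal_down (ideal_diagram la_part).
have r1 : (u.2 < row_len B (mem lam) u.1)%N.
  by rewrite (row_lenE _ _ dl diagram_box) -surjective_pairing.
have c1 : (u.1 < col_len N (mem lam) u.2)%N.
  by rewrite (col_lenE _ _ dl diagram_box) -surjective_pairing.
have r2 := row_lenE u.1 u.1 dl diagram_box; rewrite /= in r2.
have c2 := col_lenE u.2 u.2 dl diagram_box; rewrite /= in c2.
have [uN _] := diagram_box ul.
have cN : (col_len N (mem lam) u.2 <= N)%N.
  rewrite -[X in (_ <= X)%N]card_ord -sum1_card /col_len.
  by apply: leq_sum => i _; exact: leq_b1.
have hE : (hook la u + (N + u.2.+1 - col_len N (mem lam) u.2)
           = row_pos N B (mem lam) u.1)%N.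
  rewrite /hook -row_len_diagram -col_len_diagram /row_pos.
  move: r1 c1 uN cN; move: (row_len _ _ _) (col_len _ _ _) => r c.
  by clear; case: u => i j /=; lia.
(* Row i passes position N when (i, i) is in la, and column j does when (j, j) is not. As (i, j) is
   in la, at least one of (i, i) and (j, j) is too, so the difference is 1 on the Durfee square and
   0 elsewhere, never negative. *)
have tE : ((u \in durfee la) + (N < N + u.2.+1 - col_len N (mem lam) u.2)
           = (N < row_pos N B (mem lam) u.1))%N.
  rewrite in_durfee // -r2 -c2 /row_pos; move: r1 c1 uN cN; rewrite -/lam.
  move: (row_len _ _ _) (col_len _ _ _) => r c.
  by clear; case: u => i j /=; lia.
by rewrite /hook_weight /label mulrACA -!exprD hE tE.
Qed.

(** Each row end moves by the number of cells of lam outside K in that row, which sums to the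
    exponent of q. Row i ends past position N exactly when (i, i) is in the shape, which gives the
    diagonal cells and the exponent of t. *)
Lemma label_row_prod K : ideal K -> (K `<=` lam)%fset ->
  \prod_(i < N) label (row_pos N B (mem lam) i) =
  row_prod N B label K * (q ^+ outside lam K * t ^+ diag_outside lam K).
Proof.
move=> iK Kl; have dl := ideal_down (ideal_diagram la_part).
have bK : in_box N B (mem K) by move=> z zK; apply/diagram_box/(fsubsetP Kl).
have sub z : z \in K -> z \in lam by exact: fsubsetP Kl z.
rewrite /row_prod /label !big_split /= -!expr_sum mulrACA -!exprD.
have -> : (\sum_(i < N) row_pos N B (mem lam) i =
    \sum_(i < N) row_pos N B (mem K) i + outside lam K)%N.
  rewrite /outside; have -> := box_sum xpredT (fun u => nat_of_bool (u \notin K)) diagram_box.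
  rewrite -big_split; apply: eq_bigr => i _ /=.
  have -> : (row_pos N B (mem lam) i = row_pos N B (mem K) i +
      (row_len B (mem lam) i - row_len B (mem K) i))%N.
    have : (row_len B (mem K) i <= row_len B (mem lam) i)%N.
      apply: leq_sum => j _ /=; case zK: (_ \in K) => //.
      by rewrite (sub _ zK).
    by have := ltn_ord i; rewrite /row_pos; lia.
  congr (_ + _)%N; apply/eqP; rewrite -(eqn_add2l (row_len B (mem K) i)) subnKC.
    rewrite /row_len -big_split; apply/eqP/eq_bigr => j _ /=.
    case zK: (_ \in K); first by rewrite (sub _ zK).
    by case: (_ \in lam).
  apply: leq_sum => j _ /=; case zK: (_ \in K) => //.
  by rewrite (sub _ zK).
have -> : (\sum_(i < N) (N < row_pos N B (mem lam) i) =
    \sum_(i < N) (N < row_pos N B (mem K) i) + diag_outside lam K)%N.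
  rewrite /diag_outside.
  have -> := box_sum (fun u => u.1 == u.2) (fun u => nat_of_bool (u \notin K)) diagram_box.
  rewrite -big_split; apply: eq_bigr => i _ /=.
  have diag (A : {fset cell}) : ideal A -> in_box N B (mem A) ->
      (N < row_pos N B (mem A) i)%N = ((nat_of_ord i, nat_of_ord i) \in A).
    move=> iA bA; have := row_lenE i i (ideal_down iA) bA.
    by rewrite /= => <-; have := ltn_ord i; rewrite /row_pos; lia.
  rewrite !diag //; last exact: diagram_box; last exact: ideal_diagram.
  case: (boolP ((nat_of_ord i, nat_of_ord i) \in lam)) => il; last first.
    rewrite big1 => [|j _].
      by rewrite addn0; case zK: (_ \in K) => //; rewrite (sub _ zK) in il.
    by case: eqVneq => [<-|]; rewrite ?andbF // andbT (negPf il).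
  have [_ iB] := diagram_box il.
  rewrite (bigD1 (Ordinal iB)) //= il eqxx /= big1 ?addn0 => [|j ne].
    by case: (_ \in K).
  rewrite ifN // negb_and; apply/orP; right; apply: contra ne => /eqP e.
  by apply/eqP/val_inj.
by [].
Qed.

Lemma lreg_row_prod K : GRing.lreg (row_prod N B label K).
Proof.
rewrite /row_prod /label big_split /= -!expr_sum.
by apply: GRing.lregM; apply: GRing.lregX; [exact: lreg_q | exact: lreg_t].
Qed.

(** The transform over all ideals of lam, with each coefficient evaluated by [mobius_hecke] for the
    labels of lam; the factor [row_prod] common to both sides is regular and cancels. *)
Lemma hecke_rec s K : linext s -> s =i lam -> ideal K -> (K `<=` lam)%fset ->
  hecke hook_weight s K =
  \sum_(L <- fpowerset lam | ideal L && (K `<=` L)%fset)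
     q ^+ outside lam L * t ^+ diag_outside lam L * hecke hook_weight s L.
Proof.
move=> ls sE iK Kl; rewrite (hecke_mobius _ _ iK Kl).
rewrite big_seq_cond [RHS]big_seq_cond; apply: eq_bigr => L.
rewrite fpowersetE => /and3P[Ll iL _]; apply: (@lreg_row_prod L).
have rl i : row_pos N B (mem s) i = row_pos N B (mem lam) i.
  by rewrite /row_pos; congr (_ + _ - _)%N; apply: eq_bigr => j _; rewrite /= sE.
have cl j : col_len N (mem s) j = col_len N (mem lam) j.
  by apply: eq_bigr => i _; rewrite /= sE.
rewrite (@mobius_hecke N B _ hook_weight lam s
  (fun i => label (row_pos N B (mem lam) i))
  (fun j => label (N + j.+1 - col_len N (mem lam) j))) //.
- by rewrite (label_row_prod iL Ll) -mulrA.
- exact: ideal_diagram.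
- exact: diagram_box.
- by move=> z; rewrite sE.
- by move=> v; rewrite sE; exact: hook_weight_label.
- by move=> i _; rewrite rl.
- by move=> j _; rewrite cl.
Qed.

Lemma unit_hook_weight u : 1 - hook_weight u \is a GRing.unit.
Proof.
rewrite /hook_weight; have h0 : (0 < hook la u)%N by rewrite /hook addn1.
case: (u \in durfee la); first by rewrite mulrC expr1; exact: unit_1Btq.
by rewrite expr0 mulr1; exact: unit_1Bq.
Qed.

End Weights.

(** * Matching the products in hooks, and the theorem *)

Lemma prod_durfee_split la (A : {fset cell}) :
  \prod_(u <- (A `&` durfee la)%fset) (1 - t * q ^+ hook la u)^-1 *
  \prod_(u <- (A `\` durfee la)%fset) (1 - q ^+ hook la u)^-1 =
  \prod_(u <- A) (1 - hook_weight la u)^-1 :> fps_qt.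
Proof.
rewrite [RHS](big_fsetID _ (fun u => u \in durfee la)) /=; congr (_ * _).
  rewrite (_ : [fset u in A | _]%fset = (A `&` durfee la)%fset); last first.
    by apply/fsetP => z; rewrite in_fset_sep in_fsetI.
  rewrite big_seq_cond [RHS]big_seq_cond; apply: eq_bigr => u.
  by rewrite andbT in_fsetI /hook_weight => /andP[_ ->]; rewrite mulrC.
rewrite (_ : [fset u in A | _]%fset = (A `\` durfee la)%fset); last first.
  by apply/fsetP => z; rewrite in_fset_sep in_fsetD andbC.
rewrite big_seq_cond [RHS]big_seq_cond; apply: eq_bigr => u.
by rewrite andbT in_fsetD /hook_weight => /andP[/negPf -> _]; rewrite mulr1.
Qed.

Lemma peaks_weight la mu D :
  q ^+ peak_hooks la mu D * t ^+ durfee_peaks la mu D =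
  \prod_(u <- peaks la mu D) hook_weight la u.
Proof.
rewrite /hook_weight big_split /= -!expr_sum; congr (_ * _ ^+ _).
rewrite /durfee_peaks card_fset_sum1 [RHS](big_fsetID _ (fun u => u \in durfee la)) /=.
rewrite [X in (_ + X)%N]big1_fset ?addn0 => [|u]; last first.
  by rewrite in_fset_sep => /andP[_ /negPf ->].
rewrite (_ : [fset u in _ | _]%fset = (peaks la mu D `&` durfee la)%fset); last first.
  by apply/fsetP => z; rewrite in_fset_sep in_fsetI.
rewrite big_seq_cond [RHS]big_seq_cond; apply: eq_bigr => u.
by rewrite andbT in_fsetI => /andP[_ ->].
Qed.

Lemma prod_inv_fsetD la (A D : {fset cell}) : (D `<=` A)%fset ->
  \prod_(u <- (A `\` D)%fset) (1 - hook_weight la u)^-1 =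
  \prod_(u <- D) (1 - hook_weight la u) * \prod_(u <- A) (1 - hook_weight la u)^-1.
Proof.
move=> DA; rewrite [in RHS](big_fsetID _ (fun u => u \in D) A) /=.
rewrite (_ : [fset u in A | u \in D]%fset = D); last first.
  apply/fsetP => z; rewrite in_fset_sep; apply/andP/idP => [[]//|zD].
  by split=> //; exact: fsubsetP DA z zD.
rewrite (_ : [fset u in A | _]%fset = (A `\` D)%fset); last first.
  by apply/fsetP => z; rewrite in_fset_sep in_fsetD andbC.
rewrite mulrA -big_split /= [X in X * _]big1 ?mul1r // => u _.
by rewrite divrr // unit_hook_weight.
Qed.

Theorem corollary6p20 (la mu : seq nat) (la_part : is_part la)
    (mu_part : is_part mu) (mu_sub_la : (diagram mu `<=` diagram la)%fset) :
  fps_sum (rpp la mu) (fun pi => q ^+ rpp_size pi * t ^+ rpp_trace pi) =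
  \sum_(D <- excited_diagrams la mu)
    q ^+ peak_hooks la mu D * t ^+ durfee_peaks la mu D *
    (\prod_(u <- ((diagram la `\` D) `&` durfee la)%fset)
       (1 - t * q ^+ hook la u)^-1) *
    (\prod_(u <- ((diagram la `\` D) `\` durfee la)%fset)
       (1 - q ^+ hook la u)^-1).
Proof.
have ila := ideal_diagram la_part; have imu := ideal_diagram mu_part.
have [s ls sE] := linext_exists ila.
pose w := hook_weight la; pose Z := \prod_(u <- diagram la) (1 - w u)^-1.
pose G K := hecke w s K * Z.
have recG K : ideal K -> (K `<=` diagram la)%fset ->
    G K = \sum_(L <- fpowerset (diagram la) | ideal L && (K `<=` L)%fset)
      q ^+ outside (diagram la) L * t ^+ diag_outside (diagram la) L * G L.
  move=> iK Kla; rewrite /G (hecke_rec la_part ls sE iK Kla) mulr_suml.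
  by apply: eq_bigr => L _; rewrite mulrA.
have G1 : G (diagram la) = 1.
  rewrite /G (hecke_full w ls ila sE) /Z -big_split /= big1 // => u _.
  by rewrite divrr // unit_hook_weight.
have -> : fps_sum (rpp la mu) (fun pi => q ^+ rpp_size pi * t ^+ rpp_trace pi) =
    G (diagram mu).
  apply/fpsP => n; rewrite (fcoef_rpp_sum la_part mu_part).
  exact: rpp_coef_unique ila recG G1 _ _ imu mu_sub_la (leqnn n).
(* Only here are the ideals those of mu; the recursion used above runs over the ideals of la. *)
rewrite /G -(mobius_top w s imu) -(sum_configs _ _ _ ls) mulr_suml.
rewrite -(perm_big _ (configs_excited la_part mu_part mu_sub_la ls sE)) big_map /=.
rewrite big_seq_cond [RHS]big_seq_cond; apply: eq_bigr => X; rewrite andbT => XC.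
have [eX pX] := configs_peaks la_part mu_part mu_sub_la ls sE XC.
have XD : (X.1 `<=` diagram la)%fset.
  move/(in_excited_diagrams _ mu_sub_la): eX.
  by rewrite !inE /= fpowersetE => /andP[].
by rewrite -[RHS]mulrA prod_durfee_split peaks_weight pX prod_inv_fsetD // -mulrA.
Qed.
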